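(* Let $m\ge1$ and let $\mathfrak{b}_1,\dots,\mathfrak{b}_m,\mathfrak{s}$ be subspaces of a real Lie algebra of matrices such that the sum $\mathfrak{b}=\mathfrak{b}_1\oplus\dots\oplus\mathfrak{b}_m$ is direct, and let $b_\star=b_{\star,1}+\dots+b_{\star,m}\in\mathfrak{b}$ ($b_{\star,j}\in\mathfrak{b}_j$) be such that $\mathfrak{g}:=\mathfrak{b}+\mathrm{ad}_{b_\star}(\mathfrak{s})$ is a real Lie algebra. Let $\mathfrak{r},\mathfrak{s}',\Psi,\Pi_{\mathfrak{b}},\Pi_{\mathfrak{r}},s_\star$ and $t_0$, $(b_t,s_t)_{|t|<t_0}$ be as described in the context. Then there exists $t_1\in(0,t_0)$ such that for all $t\in(-t_1,t_1)\setminus\{0\}$ the sequence $(b_t^{(k)},s_t^{(k)})_{k\in\mathbb{N}}$ in $\mathfrak{b}\times\mathfrak{s}'$ is well defined by induction as follows: $b_t^{(0)}=b_\star$, $s_t^{(0)}=s_\star$, and for $k\ge0$ $$\begin{cases} b_t^{(k+1)}=b_t^{(k)}+b_\star-\Pi_{\mathfrak{b}}\,g^{(k)},\\ s_t^{(k+1)}=s_t^{(k)}-t^{-1}\Psi^{-1}\Pi_{\mathfrak{r}}\,g^{(k)},\end{cases}\qquad g^{(k)}=t^{-1}\log\!\left(e^{-ts_t^{(k)}}e^{tb_{t,1}^{(k)}}\cdots e^{tb_{t,m}^{(k)}}e^{ts_t^{(k)}}\right),$$ where $b_t^{(k)}=b_{t,1}^{(k)}+\dots+b_{t,m}^{(k)}$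 with $b_{t,j}^{(k)}\in\mathfrak{b}_j$. Furthermore, there exists $C>0$ independent of $t$ and $k$ such that for all $k\ge0$ and all $t\in(-t_1,t_1)\setminus\{0\}$, $$|b_t^{(k)}-b_t|+|s_t^{(k)}-s_t|\le C\,2^{-k}.$$
   Context: A real Lie algebra of matrices is a Lie subalgebra of $\mathfrak{gl}_N(\mathbb{R})$ for some $N$, with $[A,B]=AB-BA$; $\mathrm{ad}_xy=[x,y]$. $\log$ is the principal matrix logarithm; $|\cdot|$ is a fixed norm. Since $\mathfrak{g}=\mathfrak{b}+\mathrm{ad}_{b_\star}(\mathfrak{s})$, there exist a complement $\mathfrak{r}$ of $\mathfrak{b}$ in $\mathfrak{g}$ and a subspace $\mathfrak{s}'\subset\mathfrak{s}$ such that, denoting by $\Pi_{\mathfrak{b}},\Pi_{\mathfrak{r}}$ the projections associated with the decomposition $\mathfrak{g}=\mathfrak{b}\oplus\mathfrak{r}$, the map $\Psi:=\Pi_{\mathfrak{r}}\circ\mathrm{ad}_{b_\star}:\mathfrak{s}'\to\mathfrak{r}$ is a vector space isomorphism. Such $\mathfrak{r},\mathfrak{s}'$ are fixed. Define $$s_\star=-\tfrac12(\Psi^{-1}\circ\Pi_{\mathfrak{r}})\Big(\sum_{1\le i<j\le m}[b_{\star,i},b_{\star,j}]\Big)\in\mathfrak{s}'.$$ The number $t_0>0$ and the analytic map $t\in(-t_0,t_0)\mapsto(b_t,s_t)\in\mathfrak{b}\times\mathfrak{s}'$ are such that $(b_0,s_0)=(b_\star,s_\star)$ and $e^{tb_\star}=e^{-ts_t}e^{tb_{t,1}}\cdots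 e^{tb_{t,m}}e^{ts_t}$ for all $|t|<t_0$, where $b_t=\sum_j b_{t,j}$, $b_{t,j}\in\mathfrak{b}_j$ (such a map exists, by the paper's exact splitting theorem and its construction through the implicit function theorem).
   Formalization: That each g^(k) lies in g, where Π_b and Π_r are defined, is proved only when [g,s'] ⊂ g (e.g. s ⊂ g), since it can fail otherwise; in general Π_b, Π_r are any linear extensions to all matrices with values in b, r, and the bound holds for each choice. *)

(* Defs.v *)
From HB Require Import structures.
From mathcomp Require Import all_boot all_order all_algebra.
From mathcomp Require Import complex.
From mathcomp Require Import all_classical all_reals all_analysis.

Set Implicit Arguments.
Unset Strict Implicit.
Unset Printing Implicit Defensive.

Import Order.TTheory GRing.Theory Num.Theory.
Import numFieldNormedType.Exports.

Local Open Scope classical_set_scope.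
Local Open Scope ring_scope.

Section LieAlgebra.
Context {R : fieldType} {N : nat}.
Implicit Types (A B : 'M[R]_N) (U V : {vspace 'M[R]_N}).

Definition lie_bracket A B : 'M[R]_N := A *m B - B *m A.

Lemma lie_bracket_is_linear A : linear (lie_bracket A).
Proof.
move=> a B C; rewrite /lie_bracket mulmxDr mulmxDl -scalemxAr -scalemxAl.
by rewrite scalerBr opprD addrACA.
Qed.

HB.instance Definition _ A :=
  GRing.isSemilinear.Build R 'M[R]_N 'M[R]_N _ (lie_bracket A)
    (GRing.semilinear_linear (lie_bracket_is_linear A)).

Definition ad A : 'End('M[R]_N) := linfun (lie_bracket A).

Definition lie_subalgebra U : Prop := {in U &, forall A B, lie_bracket A B \in U}.

(* [P] is a linear map on all matrices, with values in [U], whose restriction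
   to [U + V] is the projection onto [U] along [V].  What [P] does off [U + V]
   is not constrained: when [ad] of the conjugating space does not preserve
   [g = b + r], the iteration below can leave [g], so that the projections have
   to be applied to matrices outside of [g]. *)
Definition projection_along U V (P : 'End('M[R]_N)) : Prop :=
  (limg P <= U)%VS /\ {in U & V, forall u v, P (u + v) = u}.

(* the [j]-th component of [v], when the sum of the [bb i] is direct *)
Definition component m (bb : 'I_m -> {vspace 'M[R]_N}) (j : 'I_m)
  (v : 'M[R]_N) : 'M[R]_N := sumv_pi (\sum_(i < m) bb i)%VS j v.

Definition Psi (bs : 'M[R]_N) (Pr : 'End('M[R]_N)) (s' r : {vspace 'M[R]_N}) :
    'Hom(subvs_of s', subvs_of r) :=
  (linfun (@vsproj _ _ r) \o Pr \o ad bs \o linfun (@vsval _ _ s'))%VF.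

(* [Psi^-1], as a map from matrices (meant to lie in [r]) to matrices in [s'];
   [^-1] on linear maps is the two-sided inverse when [Psi] is bijective. *)
Definition Psi_inv (bs : 'M[R]_N) (Pr : 'End('M[R]_N))
    (s' r : {vspace 'M[R]_N}) (y : 'M[R]_N) : 'M[R]_N :=
  vsval (((Psi bs Pr s' r)^-1)%VF (vsproj r y)).

Definition s_star m (bsj : 'I_m -> 'M[R]_N) (Pr : 'End('M[R]_N))
    (s' r : {vspace 'M[R]_N}) : 'M[R]_N :=
  - (2^-1 *: Psi_inv (\sum_(j < m) bsj j) Pr s' r
       (Pr (\sum_(i < m) \sum_(j < m | (i < j)%N) lie_bracket (bsj i) (bsj j)))).

End LieAlgebra.

Section Analysis.
Context {R : realType}.

Definition is_norm (V : lmodType R) (nrm : V -> R) : Prop :=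
  [/\ forall x y, nrm (x + y) <= nrm x + nrm y,
      forall a x, nrm (a *: x) = `|a| * nrm x &
      forall x, nrm x = 0 -> x = 0].

Definition analytic_on (V : normedModType R) (D : set R) (f : R -> V) : Prop :=
  forall a, D a -> exists (c : nat -> V) (e : R), 0 < e /\
    forall h, `|h| < e ->
      series (fun k => h ^+ k *: c k) @ \oo --> f (a + h).

Context {N : nat}.
Implicit Types (A X : 'M[R]_N).

Definition expm A : 'M[R]_N :=
  lim (series (fun k => (k`!%:R : R)^-1 *: A ^+ k) @ \oo).

(* The principal logarithm of a real matrix with no eigenvalue in ]-oo, 0] is
   its unique logarithm whose complex eigenvalues all lie in the open strip
   [|Im z| < pi]. *)
Definition principal_log_domain A : Prop :=
  forall a : R, a <= 0 -> ~~ eigenvalue A a.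

Definition is_principal_log A X : Prop :=
  expm X = A /\
  forall z : R[i], eigenvalue (map_mx (real_complex R) X) z ->
    `|complex.Im z| < pi.

Definition logm A : 'M[R]_N := xget 0 [set X | is_principal_log A X].

Section Iteration.
Variables (m : nat) (bb : 'I_m -> {vspace 'M[R]_N}).

(* e^{-ts} e^{t b_1} ... e^{t b_m} e^{ts}, where b_j is the component of b *)
Definition splitting (t : R) (b s : 'M[R]_N) : 'M[R]_N :=
  expm (- t *: s) * (\prod_(j < m) expm (t *: component bb j b)) * expm (t *: s).

Definition log_splitting (t : R) (b s : 'M[R]_N) : 'M[R]_N :=
  t^-1 *: logm (splitting t b s).

Variables (bsj : 'I_m -> 'M[R]_N) (r s' : {vspace 'M[R]_N}).
Variables (Pb Pr : 'End('M[R]_N)).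

Fixpoint iterates (t : R) (k : nat) : 'M[R]_N * 'M[R]_N :=
  let bs := \sum_(j < m) bsj j in
  if k is k'.+1 then
    let: (b, s) := iterates t k' in
    let g := log_splitting t b s in
    (b + bs - Pb g, s - t^-1 *: Psi_inv bs Pr s' r (Pr g))
  else (bs, s_star bsj Pr s' r).

End Iteration.
End Analysis.

(* Main.v *)
Require Import Defs.
From HB Require Import structures.
From mathcomp Require Import all_boot all_order all_algebra.
From mathcomp Require Import complex spectral.
From mathcomp Require Import ring lra.
From mathcomp Require Import all_classical all_reals all_analysis.

Set Implicit Arguments.
Unset Strict Implicit.
Unset Printing Implicit Defensive.

Import Order.TTheory GRing.Theory Num.Theory.
Import numFieldNormedType.Exports.

Local Open Scope classical_set_scope.
Local Open Scope ring_scope.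

(** The iteration is a quasi-Newton method for the equation
    g(t, b, s) = b_star, where t g is the logarithm of the conjugated product.
    By the second order Baker-Campbell-Hausdorff formula,

      g(t, b, s) = b + t (1/2 sum_(i < j) [b_i, b_j] + [b, s]) + O(t^2)

    with a remainder that is also Lipschitz in (b, s) with constant O(t^2)
    ([log_splitting_expansion]).  The exact pair (b_t, s_t) is a fixed point of
    the iteration, because its splitting is exp (t b_star) and the principal
    logarithm of that matrix is t b_star for small t.  Subtract one step at
    (b_t, s_t) from one step at (b, s), and write db, ds for the errors.  The
    projection on b reproduces db exactly, so that the new error in b is O(t) in
    (db, ds).  In the other component, the projection on r kills db, and
    Psi^-1 Pi_r [b_star, ds] = ds cancels the old error; what is left is O(db),
    plus O(|b - b_star|) ds, plus O(t) ([iteration_estimate]).  The term O(db)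
    is not small, but db itself becomes O(t) in one step: in the weighted
    distance (4 K + 1) |db| + |ds| every step halves the error, as long as t and
    |b - b_star| are small ([weighted_contraction]).  The starting point
    (b_star, s_star) = (b_0, s_0) is close to (b_t, s_t) because analytic maps
    are continuous, so the iterates never leave the region where this works
    ([iterates_converge]).

    Three ingredients have to be built from the exponential series.

    The expansion comes from a calculus of families of matrices of order t^k
    jointly with their Lipschitz constants ([lipO]).  It is stable under
    products, the exponential and the logarithm, and a second order jet in
    exponential form is multiplicative up to a bracket ([has_exp_jet_mul]).

    The logarithm of the statement is defined by its spectrum.  If Y is small
    and X is any principal logarithm of exp Y, then X = Y ([logm_expm]): X
    commutes with exp Y, hence with Y, since the differential of exp is
    injective at Y; then exp (X - Y) = 1, and the imaginary parts of the
    eigenvalues of X - Y that come from common eigenvectors are smaller than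
    2 pi, which excludes all the periods of exp but 0.

    For membership of the logarithm in g, conjugation by exp S acts on g by the
    exponential of ad S, and the logarithm of a product of exponentials of small
    elements of g lies in g ([bch_mem]).  Indeed, it is the value at time 1 of
    the solution of a differential equation whose vector field preserves g;
    Euler's method produces approximations that stay in g, and g is closed. *)

(* Completeness of matrix spaces is what Banach's fixed point theorem uses. *)
HB.instance Definition _ (R : realType) (m n : nat) := Complete.on 'M[R]_(m, n).

(** * A submultiplicative norm on square matrices *)

(** The factor makes the entrywise maximum submultiplicative; it is [N.+1] and not
    [N], so that [nm] is a norm bounding the maximum even for [N = 0].  It is locked
    to keep arithmetic tactics from looking inside it. *)
HB.lock Definition nm (R : realType) (N : nat) (A : 'M[R]_N) : R := N.+1%:R * `|A|.

Section SubmultiplicativeNorm.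
Context {R : realType} {N : nat}.
Implicit Types (A B : 'M[R]_N).

Lemma nm_ge0 A : 0 <= nm A.
Proof. by rewrite nm.unlock mulr_ge0. Qed.

Lemma norm_le_nm A : `|A| <= nm A.
Proof. by rewrite nm.unlock ler_peMl // ler1n. Qed.

Lemma nm0 : nm (0 : 'M[R]_N) = 0.
Proof. by rewrite nm.unlock normr0 mulr0. Qed.

Lemma nm_eq0 A : nm A = 0 -> A = 0.
Proof.
by rewrite nm.unlock => /eqP; rewrite mulf_eq0 pnatr_eq0 /= normr_eq0 => /eqP.
Qed.

Lemma nmD A B : nm (A + B) <= nm A + nm B.
Proof. by rewrite nm.unlock -mulrDr ler_wpM2l ?ler_normD. Qed.

Lemma nmN A : nm (- A) = nm A.
Proof. by rewrite nm.unlock normrN. Qed.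

Lemma nmB A B : nm (A - B) <= nm A + nm B.
Proof. by rewrite -(nmN B) nmD. Qed.

Lemma nmZ a A : nm (a *: A) = `|a| * nm A.
Proof. by rewrite nm.unlock normrZ mulrCA. Qed.

Lemma nm_distC A B : nm (A - B) = nm (B - A).
Proof. by rewrite -nmN opprB. Qed.

Lemma nm_triangle C A B : nm (A - B) <= nm (A - C) + nm (C - B).
Proof. by apply: le_trans (nmD _ _); rewrite addrA subrK. Qed.

Lemma nm_sum (I : Type) (s : seq I) (P : pred I) (F : I -> 'M[R]_N) :
  nm (\sum_(i <- s | P i) F i) <= \sum_(i <- s | P i) nm (F i).
Proof.
elim/big_ind2: _ => [|x a y b xa yb|//]; first by rewrite nm0.
exact: le_trans (nmD _ _) (lerD xa yb).
Qed.

Lemma coord_le_norm A i j : `|A i j| <= `|A|.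
Proof.
by rewrite {2}/Num.norm /= mx_normrE; apply: (le_bigmax _ _ (i, j)).
Qed.

Lemma coord_le_nm A i j : `|A i j| <= nm A.
Proof.
exact: le_trans (coord_le_norm A i j) (norm_le_nm A).
Qed.

Lemma nmM A B : nm (A * B) <= nm A * nm B.
Proof.
rewrite nm.unlock -mulrA ler_wpM2l // mulrCA.
have lt0 : 0 <= N.+1%:R * (`|A| * `|B|) by rewrite mulr_ge0 // mulr_ge0.
rewrite {1}/Num.norm /= mx_normrE.
apply/bigmax_leP; split=> [//|[i j] _ /=]; rewrite mxE.
apply: le_trans (ler_norm_sum _ _ _) _.
apply: le_trans (_ : \sum_(k < N) `|A| * `|B| <= _).
  by apply: ler_sum => k _; rewrite normrM ler_pM // coord_le_norm.
rewrite sumr_const card_ord -[leLHS]mulr_natl ler_wpM2r ?mulr_ge0 //.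
by rewrite ler_nat.
Qed.

Lemma nmX A k : nm (A ^+ k.+1) <= nm A ^+ k.+1.
Proof.
elim: k => [|k IHk]; first by rewrite !expr1.
rewrite exprS [leRHS]exprS; apply: le_trans (nmM _ _) _.
by rewrite ler_wpM2l ?nm_ge0.
Qed.

Lemma nm1 : nm (1 : 'M[R]_N) <= N.+1%:R.
Proof.
rewrite nm.unlock -[leRHS]mulr1 ler_wpM2l // {1}/Num.norm /= mx_normrE.
apply/bigmax_leP; split=> [//|[i j] _ /=]; rewrite mxE.
by case: eqP => _; rewrite ?normr1 ?normr0.
Qed.

Lemma nmX1 A k a : nm A <= a -> nm (A ^+ k) <= N.+1%:R * a ^+ k.
Proof.
move=> Aa; have a0 : 0 <= a := le_trans (nm_ge0 A) Aa.
case: k => [|k]; first by rewrite !expr0 mulr1 nm1.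
apply: le_trans (nmX _ _) _; apply: le_trans (_ : a ^+ k.+1 <= _).
  by rewrite lerXn2r ?nnegrE ?nm_ge0.
by rewrite ler_peMl ?exprn_ge0 // ler1n.
Qed.

(** Linear maps of matrices are bounded, as one sees on the canonical basis. *)
Lemma mx_lin_bound (f : {linear 'M[R]_N -> 'M[R]_N}) :
  exists2 K, 0 <= K & forall A, nm (f A) <= K * nm A.
Proof.
exists (\sum_i \sum_j nm (f (delta_mx i j))) => [|A].
  by apply: sumr_ge0 => i _; apply: sumr_ge0 => j _; apply: nm_ge0.
rewrite {1}(matrix_sum_delta A) linear_sum; apply: le_trans (nm_sum _ _ _) _.
rewrite mulr_suml; apply: ler_sum => i _.
rewrite linear_sum; apply: le_trans (nm_sum _ _ _) _.
rewrite mulr_suml; apply: ler_sum => j _.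
by rewrite linearZ /= nmZ mulrC ler_wpM2l ?nm_ge0 ?coord_le_nm.
Qed.

Lemma cvg_nm (u : nat -> 'M[R]_N) l (e : nat -> R) :
  e @ \oo --> 0 -> (forall n, nm (u n - l) <= e n) -> u @ \oo --> l.
Proof.
move=> e0 ule; apply/cvgrPdist_le => eps eps0.
move/cvgrPdist_le : e0 => /(_ _ eps0); apply: filterS => n.
rewrite sub0r normrN => en; rewrite distrC.
apply: le_trans (le_trans (ler_norm _) en); exact: le_trans (norm_le_nm _) (ule n).
Qed.

Lemma nm_cvg (u : nat -> 'M[R]_N) l :
  u @ \oo --> l -> (fun n => nm (u n - l)) @ \oo --> 0.
Proof.
move=> ul; rewrite nm.unlock -(mulr0 N.+1%:R); apply: cvgMr.
have -> : (0 : R) = `|l - l| by rewrite subrr normr0.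
apply: cvg_norm; apply: cvgB => //; exact: cvg_cst.
Qed.

Lemma lipschitz_cvg (f : 'M[R]_N -> 'M[R]_N) K (u : nat -> 'M[R]_N) l :
  (forall A B, nm (f A - f B) <= K * nm (A - B)) ->
  u @ \oo --> l -> (f \o u) @ \oo --> f l.
Proof.
move=> fK ul; apply: (@cvg_nm _ _ (fun n => K * nm (u n - l))) => [|n].
  by rewrite -(mulr0 K); apply: cvgMr; apply: nm_cvg.
exact: fK.
Qed.

Lemma mx_lin_cvg (f : {linear 'M[R]_N -> 'M[R]_N}) (u : nat -> 'M[R]_N) l :
  u @ \oo --> l -> (f \o u) @ \oo --> f l.
Proof.
have [K _ fK] := mx_lin_bound f; apply: (@lipschitz_cvg _ K) => A B.
by rewrite -linearB fK.
Qed.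

(** A subspace is the kernel of the linear, hence continuous, map
    [1 - projv g]. *)
Lemma vspace_closed (g : {vspace 'M[R]_N}) (u : nat -> 'M[R]_N) l :
  u @ \oo --> l -> (forall n, u n \in g) -> l \in g.
Proof.
move=> ul ug; pose q := (\1 - projv g)%VF.
have := @mx_lin_cvg q u l ul; have -> : q \o u = (fun=> 0).
  apply/funext => n /=; rewrite /q !lfunE /= !lfunE /= projv_id ?ug //.
  by rewrite subrr.
move=> /cvg_unique; move=> /(_ _ _ (cvg_cst 0)) q0.
have {}q0 : q l = 0 by apply: q0; apply: norm_hausdorff.
move: q0; rewrite /q !lfunE /= !lfunE /= => /eqP; rewrite subr_eq0 => /eqP ->.
exact: memv_proj.
Qed.

End SubmultiplicativeNorm.

(** * Series of matrices dominated by an exponential series *)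
Section MajorizedSeries.
Context {R : realType} {N : nat}.
Implicit Types (A B : 'M[R]_N) (u v w : nat -> 'M[R]_N).

(** Every series below (the exponential, its differential, the action of
    exp (ad Z)) is dominated by a scalar exponential series, so that this single
    domination serves for convergence, bounds and Cauchy products. *)
Definition majorized (c a : R) u := forall k, nm (u k) <= c * exp_coeff a k.

Definition msum u : 'M[R]_N := lim (series u @ \oo).

Lemma exp_coeff_series_le (a : R) n : 0 <= a -> series (exp_coeff a) n <= expR a.
Proof.
move=> a0; apply: nondecreasing_cvgn_le; last exact: is_cvg_series_exp_coeff.
apply: nondecreasing_series => k _ _; exact: exp_coeff_ge0.
Qed.

Lemma majorized_cvg c a u : majorized c a u -> series u @ \oo --> msum u.
Proof.
move=> uca; apply: normed_cvg.
apply: (@series_le_cvg _ _ (fun k => c * exp_coeff a k)) => [k|k|k|].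
- exact: normr_ge0.
- by apply: le_trans (uca k); apply: nm_ge0.
- exact: le_trans (norm_le_nm _) (uca k).
- have -> : (fun k => c * exp_coeff a k) = c *: exp_coeff a by [].
  apply: is_cvg_seriesZ; exact: is_cvg_series_exp_coeff.
Qed.

Lemma nm_cvg_le u l K : u @ \oo --> l -> (forall n, nm (u n) <= K) -> nm l <= K.
Proof.
move=> /nm_cvg ul uK.
have cK : (fun n => nm (u n - l) + K) @ \oo --> 0 + K.
  by apply: cvgD => //; apply: cvg_cst.
rewrite -[K]add0r; apply: (ler_cvg_to (cvg_cst (nm l)) cK).
apply: nearW => n; rewrite -{1}[l](subrK (u n)) -(nm_distC l (u n)).
by apply: le_trans (nmD _ _) _; rewrite lerD2l.
Qed.

Lemma msumP u l : series u @ \oo --> l -> msum u = l.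
Proof. by move=> ul; apply: cvg_lim => //; apply: norm_hausdorff. Qed.

Lemma nm_msum_le c a u : 0 <= a -> majorized c a u -> nm (msum u) <= c * expR a.
Proof.
move=> a0 uca; apply: (nm_cvg_le (majorized_cvg uca)) => n.
have c0 : 0 <= c.
  have := le_trans (nm_ge0 _) (uca 0%N).
  by rewrite /exp_coeff /= expr0 fact0 divr1 mulr1.
rewrite seriesEnat; apply: le_trans (nm_sum _ _ _) _.
apply: le_trans (_ : \sum_(0 <= k < n) c * exp_coeff a k <= _).
  by apply: ler_sum => k _; apply: uca.
by rewrite -mulr_sumr ler_wpM2l //; have := @exp_coeff_series_le a n a0.
Qed.

Lemma series_Lmul A u : series (fun k => A * u k) = (fun X => A * X) \o series u.
Proof. by apply/funext => n; rewrite /= !seriesEnat mulr_sumr. Qed.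

Lemma series_Rmul A u : series (fun k => u k * A) = (fun X => X * A) \o series u.
Proof. by apply/funext => n; rewrite /= !seriesEnat mulr_suml. Qed.

Lemma cvg_Lmul A u (l : 'M[R]_N) : u @ \oo --> l -> (fun k => A * u k) @ \oo --> A * l.
Proof.
by apply: (@lipschitz_cvg _ _ (fun X => A * X) (nm A)) => X Y; rewrite -mulrBr nmM.
Qed.

Lemma cvg_Rmul A u (l : 'M[R]_N) : u @ \oo --> l -> (fun k => u k * A) @ \oo --> l * A.
Proof.
apply: (@lipschitz_cvg _ _ (fun X => X * A) (nm A)) => X Y.
by rewrite -mulrBl [leRHS]mulrC nmM.
Qed.

Lemma msum_Lmul A c a u :
  majorized c a u -> A * msum u = msum (fun k => A * u k).
Proof.
by move=> /majorized_cvg uc; apply/esym/msumP; rewrite series_Lmul; apply: cvg_Lmul.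
Qed.

Lemma msum_Rmul A c a u :
  majorized c a u -> msum u * A = msum (fun k => u k * A).
Proof.
by move=> /majorized_cvg uc; apply/esym/msumP; rewrite series_Rmul; apply: cvg_Rmul.
Qed.

Lemma msumB c a u c' a' v : majorized c a u -> majorized c' a' v ->
  msum (fun k => u k - v k) = msum u - msum v.
Proof.
move=> /majorized_cvg uc /majorized_cvg vc; apply/msumP.
have -> : series (fun k => u k - v k) = series u \- series v.
  by apply/funext => n; rewrite /= !seriesEnat /= sumrB.
exact: (cvgB uc vc).
Qed.

Lemma msum_fin n u : (forall k, (n <= k)%N -> u k = 0) ->
  msum u = \sum_(k < n) u k.
Proof.
move=> u0; apply: msumP; apply: cvg_near_cst.
near=> m; rewrite seriesEnat /= -(big_mkord xpredT) (@big_cat_nat _ _ _ n 0 m) //=.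
  rewrite [X in _ + X]big_nat [X in _ + X]big1 ?addr0 // => k /andP[nk _]; exact: u0.
near: m; exact: nbhs_infty_ge.
Unshelve. all: by end_near. Qed.

Lemma msum_vspace (g : {vspace 'M[R]_N}) c a u :
  majorized c a u -> (forall k, u k \in g) -> msum u \in g.
Proof.
move=> /majorized_cvg uc ug; apply: vspace_closed uc _ => n.
by rewrite seriesEnat; apply: rpred_sum => k _; apply: ug.
Qed.

End MajorizedSeries.

Section CauchyProduct.

(** Both sides sum over the pairs with [i + j < n]. *)
Lemma triangular_sum (V : zmodType) (F : nat -> nat -> V) n :
  \sum_(k < n) \sum_(i < k.+1) F i (k - i)%N =
  \sum_(i < n) \sum_(j < n - i) F i j.
Proof.
elim: n => [|n IHn]; first by rewrite !big_ord0.
rewrite big_ord_recr IHn [RHS]big_ord_recr /= subSn // subnn big_ord1.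
rewrite [X in _ + X]big_ord_recr /= subnn addrA; congr (_ + _).
rewrite -big_split /=; apply: eq_bigr => i _.
by rewrite subSn 1?ltnW // big_ord_recr.
Qed.

Lemma cauchy_product_defect (S : pzRingType) (u v : nat -> S) n :
  (\sum_(i < n) u i) * (\sum_(j < n) v j)
    - \sum_(k < n) \sum_(i < k.+1) u i * v (k - i)%N =
  \sum_(i < n) \sum_(n - i <= j < n) u i * v j.
Proof.
rewrite (triangular_sum (fun i j => u i * v j)) mulr_suml -sumrB.
apply: eq_bigr => i _; rewrite mulr_sumr -!(big_mkord xpredT (fun j => u i * v j)).
by rewrite (@big_cat_nat _ _ _ (n - i) 0 n) ?leq_subr //= [X in X - _]addrC addrK.
Qed.

Lemma exp_coeffD (R : realType) (a b : R) k :
  exp_coeff (a + b) k = \sum_(i < k.+1) exp_coeff a i * exp_coeff b (k - i)%N.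
Proof.
rewrite /exp_coeff /= addrC exprDn mulr_suml; apply: eq_bigr => i _.
have ik : (i <= k)%N by rewrite -ltnS.
rewrite -(bin_fact ik) !natrM -mulr_natr.
have C0 : 'C(k, i)%:R != 0 :> R by rewrite pnatr_eq0 -lt0n bin_gt0.
have i0 : (i`!)%:R != 0 :> R by rewrite pnatr_eq0 -lt0n fact_gt0.
have j0 : ((k - i)`!)%:R != 0 :> R by rewrite pnatr_eq0 -lt0n fact_gt0.
by field; rewrite C0 i0 j0.
Qed.

Context {R : realType} {N : nat}.
Implicit Types (u v : nat -> 'M[R]_N).

(** The defect between the product of the partial sums and the partial sum of the
    Cauchy product is a sum over a finite set of pairs [(i, j)] with [n <= i + j].
    It is dominated by the same sum for the two scalar exponential series, which
    tends to [expR a * expR a' - expR (a + a') = 0]. *)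
Lemma cauchy_product c a u c' a' v : 0 <= a -> 0 <= a' ->
  majorized c a u -> majorized c' a' v ->
  msum u * msum v = msum (fun k => \sum_(i < k.+1) u i * v (k - i)%N).
Proof.
move=> a0 a'0 ua va; apply/esym/msumP.
set w := fun k => _; pose E n := series (exp_coeff a) n * series (exp_coeff a') n
  - series (exp_coeff (a + a')) n.
have E0 : E @ \oo --> 0.
  rewrite -(subrr (expR (a + a'))) {1}expRD; apply: cvgB.
    by apply: cvgM; apply: is_cvg_series_exp_coeff.
  exact: is_cvg_series_exp_coeff.
have uv : (fun n => series u n * series v n) @ \oo --> msum u * msum v.
  apply: (@cvg_nm _ _ _ _ (fun n => nm (series u n - msum u) * nm (series v n - msum v)
    + nm (series u n - msum u) * nm (msum v) + nm (msum u) * nm (series v n - msum v))).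
    have /nm_cvg u0 := majorized_cvg ua; have /nm_cvg v0 := majorized_cvg va.
    rewrite (_ : 0 = 0 * 0 + 0 * nm (msum v) + nm (msum u) * 0); last by rewrite !mulr0 mul0r !addr0.
    apply: cvgD; first apply: cvgD.
    - exact: cvgM.
    - by apply: cvgM => //; apply: cvg_cst.
    - by apply: cvgM => //; apply: cvg_cst.
  move=> n; set x := series u n; set y := series v n.
  have -> : x * y - msum u * msum v = (x - msum u) * (y - msum v)
      + (x - msum u) * msum v + msum u * (y - msum v).
    by rewrite -mulrDr subrK mulrBl mulrBr addrA subrK.
  apply: le_trans (nmD _ _) _; apply: lerD; last exact: nmM.
  by apply: le_trans (nmD _ _) _; apply: lerD; exact: nmM.
have -> : series w = (fun n => series u n * series v n) \- (fun n => series u n * series v n - series w n).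
  by apply/funext => n /=; rewrite opprB addrCA subrr addr0.
rewrite -[msum u * _]subr0; apply: (cvgB uv).
apply: (@cvg_nm _ _ _ _ (fun n => c * c' * E n)).
  by rewrite -(mulr0 (c * c')); apply: cvgMr.
move=> n; rewrite subr0 /E !seriesEord /= /w cauchy_product_defect.
under [X in _ * (_ - X)]eq_bigr => k _ do rewrite exp_coeffD.
rewrite cauchy_product_defect mulr_sumr; apply: le_trans (nm_sum _ _ _) _.
apply: ler_sum => i _; rewrite mulr_sumr; apply: le_trans (nm_sum _ _ _) _.
apply: ler_sum => j _; apply: le_trans (nmM _ _) _.
by rewrite [leRHS]mulrACA; apply: ler_pM; rewrite ?nm_ge0 //.
Qed.

End CauchyProduct.

(** * The matrix exponential and its Taylor remainders *)
Section ExpSeries.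
Context {R : realType} {N : nat}.
Implicit Types (A B : 'M[R]_N).

Lemma mscaleAl (a : R) A B : a *: (A * B) = (a *: A) * B.
Proof. exact: scalemxAl. Qed.

Lemma mscaleAr (a : R) A B : a *: (A * B) = A * (a *: B).
Proof. exact: scalemxAr. Qed.

Definition exp_term A k : 'M[R]_N := (k`!%:R : R)^-1 *: A ^+ k.

Lemma expmE A : expm A = msum (exp_term A).
Proof. by []. Qed.

Lemma exp_term_majorized A a : nm A <= a -> majorized N.+1%:R a (exp_term A).
Proof.
move=> Aa k; rewrite nmZ ger0_norm ?invr_ge0 // mulrC /exp_coeff /= mulrA.
by rewrite ler_wpM2r ?invr_ge0 // nmX1.
Qed.

Lemma exp_term_cauchy A B k : GRing.comm A B ->
  \sum_(i < k.+1) exp_term A i * exp_term B (k - i)%N = exp_term (A + B) k.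
Proof.
move=> AB; rewrite /exp_term addrC exprDn_comm ?scaler_sumr; last exact/esym.
apply: eq_bigr => i _; rewrite -mscaleAl -mscaleAr scalerA.
rewrite (commrX _ (commr_sym (commrX _ (commr_sym AB)))) -[_ *+ 'C(k, i)]scaler_nat scalerA.
have ik : (i <= k)%N by rewrite -ltnS.
congr (_ *: _); rewrite -(bin_fact ik) !natrM.
have C0 : 'C(k, i)%:R != 0 :> R by rewrite pnatr_eq0 -lt0n bin_gt0.
have i0 : (i`!)%:R != 0 :> R by rewrite pnatr_eq0 -lt0n fact_gt0.
have j0 : ((k - i)`!)%:R != 0 :> R by rewrite pnatr_eq0 -lt0n fact_gt0.
by field; rewrite C0 i0 j0.
Qed.

Lemma expmD A B : GRing.comm A B -> expm (A + B) = expm A * expm B.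
Proof.
move=> AB; rewrite !expmE (cauchy_product (nm_ge0 A) (nm_ge0 B)
  (exp_term_majorized (lexx _)) (exp_term_majorized (lexx _))).
by congr msum; apply/funext => k; rewrite exp_term_cauchy.
Qed.

Lemma expm0 : expm (0 : 'M[R]_N) = 1.
Proof.
rewrite expmE (@msum_fin _ _ 1) => [|[//|k] _].
  by rewrite big_ord1 /exp_term fact0 expr0 invr1 scale1r.
by rewrite /exp_term exprS mul0r scaler0.
Qed.

Lemma expmNK A : expm (- A) * expm A = 1.
Proof.
rewrite -expmD ?addNr ?expm0 //; apply/esym/commrN; exact: commr_refl.
Qed.

Lemma expmKN A : expm A * expm (- A) = 1.
Proof. by have := expmNK (- A); rewrite opprK. Qed.

Lemma comm_expm A B : GRing.comm A B -> GRing.comm A (expm B).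
Proof.
move=> AB; have maj := exp_term_majorized (lexx (nm B)).
rewrite /GRing.comm expmE (msum_Lmul _ maj) (msum_Rmul _ maj).
congr msum; apply/funext => k; rewrite /exp_term -mscaleAr -mscaleAl.
by congr (_ *: _); apply: commrX.
Qed.

Lemma nm_expm A a : nm A <= a -> nm (expm A) <= N.+1%:R * expR a.
Proof.
move=> Aa; apply: nm_msum_le (exp_term_majorized Aa).
exact: le_trans (nm_ge0 A) Aa.
Qed.

Definition exp_tail n A : 'M[R]_N := expm A - \sum_(k < n) exp_term A k.

Lemma exp_tailE n A :
  exp_tail n A = msum (fun k => if (k < n)%N then 0 else exp_term A k).
Proof.
have maj := exp_term_majorized (lexx (nm A)).
pose h k := if (k < n)%N then exp_term A k else 0.
have hmaj : majorized N.+1%:R (nm A) h.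
  move=> k; rewrite /h; case: ifP => _; first exact: maj.
  by rewrite nm0 mulr_ge0 // exp_coeff_ge0 // nm_ge0.
have hE : \sum_(k < n) exp_term A k = msum h.
  rewrite (@msum_fin _ _ n) => [|k nk]; last by rewrite /h ltnNge nk.
  by apply: eq_bigr => k _; rewrite /h ltn_ord.
rewrite /exp_tail hE expmE -(msumB maj hmaj); congr msum; apply/funext => k.
by rewrite /h; case: ifP; rewrite ?subrr ?subr0.
Qed.

Lemma nm_expr_sub A B rho k : nm A <= rho -> nm B <= rho ->
  nm (A ^+ k.+1 - B ^+ k.+1) <= k.+1%:R * rho ^+ k * nm (A - B).
Proof.
move=> Ar Br; have r0 : 0 <= rho := le_trans (nm_ge0 A) Ar.
elim: k => [|k IHk]; first by rewrite !expr1 expr0 !mul1r.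
have -> : A ^+ k.+2 - B ^+ k.+2 = A * (A ^+ k.+1 - B ^+ k.+1) + (A - B) * B ^+ k.+1.
  by rewrite mulrBr mulrBl -!exprS addrA subrK.
have -> : k.+2%:R * rho ^+ k.+1 * nm (A - B) =
    rho * (k.+1%:R * rho ^+ k * nm (A - B)) + nm (A - B) * rho ^+ k.+1.
  by rewrite -[k.+2]addn1 natrD exprS; ring.
apply: le_trans (nmD _ _) (lerD _ _); apply: le_trans (nmM _ _) _.
  by rewrite ler_pM ?nm_ge0.
rewrite ler_wpM2l ?nm_ge0 //; apply: le_trans (nmX _ _) _.
by rewrite lerXn2r ?nnegrE ?nm_ge0.
Qed.

(** The [k]-th power contributes [k * rho ^+ k.-1 / k`!] to the Lipschitz
    constant; [k <= 2 ^ k] turns the sum of the remaining series into [expR 2]. *)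
Lemma exp_tail_lipschitz n A B rho : nm A <= rho -> nm B <= rho -> rho <= 1 ->
  nm (exp_tail n.+1 A - exp_tail n.+1 B) <= rho ^+ n * nm (A - B) * expR 2.
Proof.
move=> Ar Br r1; have r0 : 0 <= rho := le_trans (nm_ge0 A) Ar.
have maj C : majorized N.+1%:R (nm C) (fun k => if (k < n.+1)%N then 0 else exp_term C k).
  move=> k; case: ifP => _; last exact: exp_term_majorized.
  by rewrite nm0 mulr_ge0 // exp_coeff_ge0 // nm_ge0.
rewrite !exp_tailE -(msumB (maj A) (maj B)); apply: nm_msum_le => // k.
have d0 := nm_ge0 (A - B).
case: ltnP => [_|nk].
  by rewrite subrr nm0 !mulr_ge0 ?exprn_ge0 ?exp_coeff_ge0.
case: k nk => // k nk.
rewrite -scalerBr nmZ ger0_norm ?invr_ge0 // /exp_coeff /= mulrA mulrC.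
rewrite ler_wpM2r ?invr_ge0 //; apply: le_trans (nm_expr_sub _ Ar Br) _.
rewrite mulrAC mulrC -!mulrA; apply: ler_pM; rewrite ?exprn_ge0 ?mulr_ge0 //.
  by rewrite ler_wiXn2l.
rewrite mulrC ler_wpM2l // -natrX ler_nat; exact/ltnW/ltn_expl.
Qed.

Lemma exp_tail0 n : exp_tail n.+1 (0 : 'M[R]_N) = 0.
Proof.
rewrite exp_tailE (@msum_fin _ _ n.+1) => [|k nk].
  by rewrite big1 // => i _; rewrite ltn_ord.
case: k nk => // k nk; rewrite ltnNge nk /= /exp_term exprS mul0r scaler0 //.
Qed.

Lemma nm_exp_tail n A rho : nm A <= rho -> rho <= 1 ->
  nm (exp_tail n.+1 A) <= rho ^+ n * nm A * expR 2.
Proof.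
move=> Ar r1; have := @exp_tail_lipschitz n A 0 rho Ar.
rewrite nm0 exp_tail0 !subr0; apply => //; exact: le_trans (nm_ge0 A) Ar.
Qed.

Lemma exp_tail1E A : expm A = 1 + exp_tail 1 A.
Proof.
by rewrite /exp_tail big_ord1 /exp_term expr0 fact0 invr1 scale1r addrC subrK.
Qed.

Lemma exp_tail2E A : expm A = 1 + A + exp_tail 2 A.
Proof.
rewrite /exp_tail 2!big_ord_recr big_ord0 /exp_term /= expr0 fact0 invr1 !scale1r.
by rewrite expr1 add0r [RHS]addrC subrK.
Qed.

Lemma exp_tail3E A : expm A = 1 + A + 2^-1 *: (A * A) + exp_tail 3 A.
Proof.
rewrite /exp_tail 3!big_ord_recr big_ord0 /exp_term /= expr0 fact0 invr1 !scale1r.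
by rewrite expr1 add0r expr2 [RHS]addrC subrK.
Qed.

End ExpSeries.

(** * Local inversion of the exponential *)
Section LocalLogarithm.
Context {R : realType} {N : nat}.
Implicit Types (A B X Y : 'M[R]_N).

Lemma lipschitz_continuous (T : normedModType R) (f : 'M[R]_N -> T) K :
  (forall A B, `|f A - f B| <= K * nm (A - B)) -> continuous f.
Proof.
move=> fK X; apply: (cvgrPdist_le (F := nbhs X) _ _).2 => e e0; near=> Y.
have K0 : 0 < `|K| * N.+1%:R + 1 by rewrite ltr_wpDl // mulr_ge0.
have XY : `|X - Y| <= e / (`|K| * N.+1%:R + 1).
  near: Y; apply: cvgr_dist_le => //; exact: divr_gt0.
apply: le_trans (fK X Y) _.
apply: le_trans (_ : `|K| * nm (X - Y) <= _).
  by rewrite ler_wpM2r ?nm_ge0 ?ler_norm.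
move: XY; rewrite ler_pdivlMr // nm.unlock mulrC => XY; apply: le_trans XY.
by rewrite mulrA ler_wpM2r // lerDl.
Unshelve. all: by end_near. Qed.

Lemma closed_ball_vspace (g : {vspace 'M[R]_N}) c :
  closed [set X : 'M[R]_N | X \in g /\ nm X <= c].
Proof.
apply: closedI; last first.
  apply: (@preimage_closed 'M[R]_N R (@nm R N) [set x | x <= c]); last exact: closed_le.
  move=> X _; apply: (@lipschitz_continuous _ _ 1) => A B; rewrite mul1r ler_norml.
  have := nmD (A - B) B; have := nmD (B - A) A; rewrite !subrK (nm_distC B A).
  by move=> h1 h2; apply/andP; split; lra.
pose q := (\1 - projv g)%VF.
have [K K0 qK] := mx_lin_bound q.
rewrite (_ : (fun X => _) = q @^-1` [set 0]).
  apply: preimage_closed; last first.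
    by apply/accessible_closed_set1/hausdorff_accessible/norm_hausdorff.
  move=> X _; apply: (@lipschitz_continuous _ _ K) => A B; rewrite -linearB.
  exact: le_trans (norm_le_nm _) (qK _).
apply/funext => X; apply/propext; rewrite /q /=; split => [Xg|].
  by rewrite !lfunE /= !lfunE /= projv_id ?subrr.
rewrite !lfunE /= !lfunE /= => /eqP; rewrite subr_eq0 => /eqP ->.
exact: memv_proj.
Qed.

(** [X |-> A - f X] is a contraction of a closed ball of [g].  That the solution
    lies in the subspace [g] is what later keeps Euler's method inside a Lie
    algebra. *)
Lemma near_identity_solve (g : {vspace 'M[R]_N}) (f : 'M[R]_N -> 'M[R]_N) rho A :
  f 0 = 0 -> (forall X, X \in g -> nm X <= rho -> f X \in g) ->
  (forall X Y, nm X <= rho -> nm Y <= rho -> nm (f X - f Y) <= 2^-1 * nm (X - Y)) ->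
  A \in g -> nm A <= rho / 2 ->
  exists X, [/\ X \in g, nm X <= 2 * nm A & X + f X = A].
Proof.
move=> f0 fg flip Ag Arho.
have r0 : 0 <= rho by have := nm_ge0 A; lra.
pose U := [set X | X \in g /\ nm X <= 2 * nm A].
have fU : {homo (fun X => A - f X) : X / U X >-> U X}.
  move=> X [Xg XA]; have Xrho : nm X <= rho by move: XA Arho; lra.
  split; first by rewrite rpredB // fg.
  have := flip X 0 Xrho; rewrite nm0 f0 !subr0 => /(_ r0) fX.
  have := nmB A (f X); lra.
have half_ge0 : 0 <= (2^-1 : R) by rewrite invr_ge0.
have [|||X [Xg XA] XE] := @banach_fixed_point R _ U (mkfun fU).
- exists (NngNum half_ge0); split => /=; first by lra.
  move=> [X Y] /= [[_ XA] [_ YA]]; rewrite /mkfun /= opprD addrACA subrr add0r.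
  rewrite -opprD normrN.
  have : nm (f X - f Y) <= 2^-1 * nm (X - Y) by apply: flip; lra.
  by rewrite nm.unlock mulrCA ler_pM2l.
- exact: closed_ball_vspace.
- by exists 0; split; rewrite ?rpred0 ?nm0 ?mulr_ge0 ?nm_ge0.
by exists X; split=> //; rewrite {1}XE /mkfun subrK.
Qed.

(** The radius on which [exp_tail 2], the nonlinear part of the exponential, has
    Lipschitz constant [1/2]. *)
Definition log_radius : R := (2 * expR 2)^-1.

Lemma log_radius_gt0 : 0 < log_radius.
Proof. by rewrite invr_gt0 mulr_gt0 ?expR_gt0. Qed.

Lemma log_radius_expR : log_radius * expR 2 = 2^-1.
Proof. by rewrite /log_radius invfM mulfVK // gt_eqF ?expR_gt0. Qed.

Lemma log_radius_le_half : log_radius <= 2^-1.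
Proof.
rewrite -log_radius_expR ler_peMr ?ltW ?log_radius_gt0 //.
by have := expR_ge1Dx (2 : R); lra.
Qed.

Lemma exp_tail2_contraction X Y : nm X <= log_radius -> nm Y <= log_radius ->
  nm (exp_tail 2 X - exp_tail 2 Y) <= 2^-1 * nm (X - Y).
Proof.
move=> Xr Yr; have r1 := log_radius_le_half.
have := exp_tail_lipschitz 1 Xr Yr; rewrite expr1 mulrAC log_radius_expR.
apply; lra.
Qed.

Lemma expm_bilipschitz X Y : nm X <= log_radius -> nm Y <= log_radius ->
  nm (X - Y) <= 2 * nm (expm X - expm Y).
Proof.
move=> Xr Yr; have := exp_tail2_contraction Xr Yr.
have -> : exp_tail 2 X - exp_tail 2 Y = (expm X - expm Y) - (X - Y).
  by rewrite (exp_tail2E X) (exp_tail2E Y); apply/matrixP => i j; rewrite !mxE; ring.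
have := nm_triangle (expm X - expm Y) (X - Y) 0; rewrite !subr0 (nm_distC (X - Y)).
lra.
Qed.

Lemma local_log_exists A : nm (A - 1) <= log_radius / 2 ->
  exists2 X, nm X <= 2 * nm (A - 1) & expm X = A.
Proof.
move=> A1; have [|||||X [_ XA XE]] :=
  @near_identity_solve fullv (exp_tail 2) log_radius (A - 1).
- exact: exp_tail0.
- by move=> *; rewrite memvf.
- exact: exp_tail2_contraction.
- exact: memvf.
- exact: A1.
by exists X => //; rewrite exp_tail2E -addrA XE addrC subrK.
Qed.

End LocalLogarithm.

(** * The differential of the exponential and the adjoint action *)
Section DexpSeries.
Context {R : realType} {N : nat}.
Implicit Types (A B D W X Y Z : 'M[R]_N).

Lemma msum_shift (u : nat -> 'M[R]_N) c a : majorized c a u ->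
  msum u = u 0%N + msum (fun k => u k.+1).
Proof.
move=> /majorized_cvg us; have := us; rewrite -cvg_shiftS => us1.
suff : series (fun k => u k.+1) @ \oo --> msum u - u 0%N.
  by move=> /msumP ->; rewrite addrC subrK.
have -> : series (fun k => u k.+1) = (fun n => series u n.+1 - u 0%N).
  apply/funext => n; rewrite !seriesEnat /= [in RHS]big_nat_recl // addrC addKr.
  by [].
exact: (cvgB us1 (cvg_cst (u 0%N))).
Qed.

(** The differential of [Z ^+ k] in the direction [D], that is, the sum of the
    [Z ^+ i * D * Z ^+ j] with [i + j = k.-1]. *)
Fixpoint power_diff Z D k : 'M[R]_N :=
  if k is k'.+1 then Z * power_diff Z D k' + D * Z ^+ k' else 0.

(** Summed over [k], this says that [[exp Y, X]] is the differential of [exp] at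
    [Y] applied to [[Y, X]]. *)
Lemma bracketX Y X k :
  Y ^+ k * X - X * Y ^+ k = power_diff Y (lie_bracket Y X) k.
Proof.
elim: k => [|k IHk] /=; first by rewrite !expr0 mul1r mulr1 subrr.
rewrite -IHk /lie_bracket !mulmxE exprS mulrBr mulrBl !mulrA.
by rewrite addrA subrK.
Qed.

Lemma nmMX D Z k : nm Z <= 1 -> nm (D * Z ^+ k) <= nm D.
Proof.
case: k => [|k] Z1; first by rewrite expr0 mulr1.
apply: le_trans (nmM _ _) _; rewrite ler_piMr ?nm_ge0 //.
by apply: le_trans (nmX _ _) _; rewrite exprn_ile1 ?nm_ge0.
Qed.

Lemma nm_power_diff Z D k : nm Z <= 1 -> nm (power_diff Z D k) <= k%:R * nm D.
Proof.
move=> Z1; elim: k => [|k IHk] /=; first by rewrite nm0 mul0r.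
rewrite -addn1 natrD mulrDl mul1r; apply: le_trans (nmD _ _) _.
apply: lerD; last exact: nmMX.
by apply: le_trans (nmM _ _) _; apply: le_trans IHk; rewrite ler_piMl ?nm_ge0.
Qed.

Lemma natr_le_exp2 k : k%:R <= 2 ^+ k :> R.
Proof. by rewrite -natrX ler_nat; apply/ltnW/ltn_expl. Qed.

Lemma nm_power_diff_rem Z D k : nm Z <= 1 -> nm (Z + D) <= 1 ->
  nm ((Z + D) ^+ k - Z ^+ k - power_diff Z D k) <= 2 ^+ k * nm D ^+ 2.
Proof.
move=> Z1 ZD1; elim: k => [|k IHk] /=.
  by rewrite !expr0 subrr subr0 nm0 mul1r sqr_ge0.
have -> : (Z + D) ^+ k.+1 - Z ^+ k.+1 - (Z * power_diff Z D k + D * Z ^+ k) =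
    (Z + D) * ((Z + D) ^+ k - Z ^+ k - power_diff Z D k) + D * power_diff Z D k.
  rewrite !mulrBr -exprS (mulrDl Z D (Z ^+ k)) (mulrDl Z D (power_diff _ _ _)) -exprS.
  by apply/matrixP => i j; rewrite !mxE; ring.
apply: le_trans (nmD _ _) _; rewrite exprS.
have -> : 2 * 2 ^+ k * nm D ^+ 2 = 2 ^+ k * nm D ^+ 2 + 2 ^+ k * nm D ^+ 2 by ring.
apply: lerD.
  by apply: le_trans (nmM _ _) _; apply: le_trans IHk; rewrite ler_piMl ?nm_ge0.
apply: le_trans (nmM _ _) _; rewrite expr2 mulrCA ler_wpM2l ?nm_ge0 //.
apply: le_trans (nm_power_diff _ _ Z1) _.
by rewrite ler_wpM2r ?nm_ge0 // natr_le_exp2.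
Qed.

Definition dexp Z D : 'M[R]_N :=
  msum (fun k => (k`!%:R : R)^-1 *: power_diff Z D k).

Lemma dexp_majorized Z D : nm Z <= 1 ->
  majorized (nm D) 2 (fun k => (k`!%:R : R)^-1 *: power_diff Z D k).
Proof.
move=> Z1 k; rewrite nmZ ger0_norm ?invr_ge0 // mulrC /exp_coeff /= mulrA.
rewrite ler_wpM2r ?invr_ge0 //; apply: le_trans (nm_power_diff _ _ Z1) _.
by rewrite mulrC ler_wpM2l ?nm_ge0 // natr_le_exp2.
Qed.

Lemma expm_dexp Z D : nm Z <= 1 -> nm (Z + D) <= 1 ->
  nm (expm (Z + D) - expm Z - dexp Z D) <= nm D ^+ 2 * expR 2.
Proof.
move=> Z1 ZD1.
have m1 := exp_term_majorized ZD1; have m2 := exp_term_majorized Z1.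
have m12 : majorized (N.+1%:R + N.+1%:R) 1
    (fun k => exp_term (Z + D) k - exp_term Z k).
  by move=> k; apply: le_trans (nmB _ _) _; rewrite mulrDl; apply: lerD.
rewrite !expmE -(msumB m1 m2) /dexp -(msumB m12 (dexp_majorized D Z1)).
apply: nm_msum_le => // k.
rewrite -!scalerBr nmZ ger0_norm ?invr_ge0 // mulrC /exp_coeff /= mulrA.
rewrite ler_wpM2r ?invr_ge0 // [leRHS]mulrC.
exact: nm_power_diff_rem.
Qed.

Definition ad_iter Z D k : 'M[R]_N := iter k (lie_bracket Z) D.

Lemma ad_iterSr Z D k : ad_iter Z (lie_bracket Z D) k = ad_iter Z D k.+1.
Proof. by rewrite /ad_iter iterSr. Qed.

Lemma nm_ad_iter Z D k : nm (ad_iter Z D k) <= (2 * nm Z) ^+ k * nm D.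
Proof.
elim: k => [|k IHk]; first by rewrite mul1r.
rewrite /ad_iter iterS -/(ad_iter Z D k) /lie_bracket.
apply: le_trans (nmB _ _) _; apply: le_trans (lerD (nmM _ _) (nmM _ _)) _.
rewrite exprS -mulrA.
have -> : nm Z * nm (ad_iter Z D k) + nm (ad_iter Z D k) * nm Z = 2 * nm Z * nm (ad_iter Z D k) by ring.
by rewrite ler_wpM2l // mulr_ge0 ?nm_ge0.
Qed.

(** Multiplication by [Z] on the right is multiplication by [Z] on the left minus
    [ad Z], and these two operators commute: this is a binomial expansion. *)
Lemma mul_powerE Z D k : D * Z ^+ k =
  \sum_(j < k.+1) ((-1) ^+ j * 'C(k, j)%:R) *: (Z ^+ (k - j) * ad_iter Z D j).
Proof.
elim: k D => [|k IHk] D.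
  by rewrite big_ord1 !expr0 bin0 !mulr1 scale1r mul1r.
have -> : D * Z ^+ k.+1 = Z * (D * Z ^+ k) - lie_bracket Z D * Z ^+ k.
  by rewrite /lie_bracket mulrBl opprB mulrA addrC subrK -mulrA -exprS.
rewrite !IHk big_ord_recl [RHS]big_ord_recl mulrDr -addrA; congr (_ + _).
  by rewrite !bin0 !subn0 -mscaleAr mulrA -exprS.
rewrite [RHS]big_ord_recr [X in _ - X]big_ord_recr opprD addrA; congr (_ + _).
  rewrite mulr_sumr -sumrB; apply: eq_bigr => i _.
  rewrite !lift0 ad_iterSr !subSS [widen_ord _ _ : nat]/= binS -mscaleAr mulrA -exprS -subSn //.
  move: (ad_iter _ _ _) => W; rewrite natrD mulrDr scalerDl; congr (_ + _).
  by rewrite exprS mulN1r mulNr scaleNr.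
rewrite !lift0 ad_iterSr [ord_max : nat]/= !subnn !binn exprS mulN1r.
by rewrite mulNr scaleNr.
Qed.

Lemma power_diffE Z D k : power_diff Z D k.+1 =
  \sum_(j < k.+1) ((-1) ^+ j * 'C(k.+1, j.+1)%:R) *: (Z ^+ (k - j) * ad_iter Z D j).
Proof.
elim: k => [|k IHk]; first by rewrite /= big_ord1 !expr0 mulr0 add0r mulr1 !mul1r scale1r.
rewrite [LHS]/= -/(power_diff Z D k.+1) IHk mul_powerE.
rewrite [X in _ + X]big_ord_recr [RHS]big_ord_recr /= addrA; congr (_ + _); last first.
  by rewrite !binn.
rewrite mulr_sumr -big_split /=; apply: eq_bigr => i _.
rewrite -mscaleAr mulrA -exprS -subSn; last by rewrite -ltnS.
by rewrite -scalerDl -mulrDr -natrD [in RHS]binS.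
Qed.

Lemma invf_fact_bin j k : (j <= k)%N ->
  (k`!%:R : R)^-1 * 'C(k, j)%:R = (j`!%:R)^-1 * ((k - j)`!%:R)^-1.
Proof.
move=> jk; rewrite -(bin_fact jk) !natrM.
have C0 : 'C(k, j)%:R != 0 :> R by rewrite pnatr_eq0 -lt0n bin_gt0.
have i0 : (j`!)%:R != 0 :> R by rewrite pnatr_eq0 -lt0n fact_gt0.
have j0 : ((k - j)`!)%:R != 0 :> R by rewrite pnatr_eq0 -lt0n fact_gt0.
by field; rewrite C0 i0 j0.
Qed.

(** The terms of [(1 - exp (- ad Z)) / ad Z] applied to [D], the differential of
    the exponential after left translation to the identity ([dexpE]). *)
Definition ltriv_term Z D k : 'M[R]_N :=
  ((-1) ^+ k / (k.+1)`!%:R) *: ad_iter Z D k.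

Definition ltriv Z D : 'M[R]_N := msum (ltriv_term Z D).

(** The terms of [exp (- ad Z)] applied to [D]. *)
Definition conj_term Z D k : 'M[R]_N :=
  ((-1) ^+ k / k`!%:R) *: ad_iter Z D k.

Lemma normr_sign k : `|(-1) ^+ k : R| = 1.
Proof. by rewrite normrX normrN1 expr1n. Qed.

Lemma conj_majorized Z D : majorized (nm D) (2 * nm Z) (conj_term Z D).
Proof.
move=> k; rewrite nmZ normrM normr_sign mul1r ger0_norm ?invr_ge0 //.
rewrite mulrC /exp_coeff /= mulrA ler_wpM2r ?invr_ge0 // mulrC.
exact: nm_ad_iter.
Qed.

Lemma ltriv_majorized Z D : majorized (nm D) (2 * nm Z) (ltriv_term Z D).
Proof.
move=> k; apply: le_trans (conj_majorized Z D k).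
rewrite !nmZ ler_wpM2r ?nm_ge0 // !normrM normr_sign !mul1r !ger0_norm ?invr_ge0 //.
by rewrite lef_pV2 ?posrE ?ltr0n ?fact_gt0 // ler_nat factS leq_pmull.
Qed.

(** In other words [exp (- Z) * X * exp Z] is [exp (- ad Z)] applied to [X]. *)
Lemma mul_expmE Z X : X * expm Z = expm Z * msum (conj_term Z X).
Proof.
have m1 := exp_term_majorized (lexx (nm Z)).
rewrite expmE (msum_Lmul _ m1).
rewrite (cauchy_product _ _ m1 (conj_majorized Z X)) ?mulr_ge0 ?nm_ge0 //.
congr msum; apply/funext => k; rewrite /exp_term -mscaleAr mul_powerE scaler_sumr.
rewrite (reindex_inj rev_ord_inj); apply: eq_bigr => i _ /=; rewrite subSS.
have ik : (i <= k)%N by rewrite -ltnS.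
rewrite subKn // /conj_term -mscaleAl -mscaleAr !scalerA; congr (_ *: _).
by rewrite mulrCA invf_fact_bin ?leq_subr // subKn //; ring.
Qed.

Lemma dexpE Z D : nm Z <= 1 -> dexp Z D = expm Z * ltriv Z D.
Proof.
move=> Z1; have m1 := exp_term_majorized (lexx (nm Z)).
rewrite /dexp (msum_shift (dexp_majorized D Z1)) /= scaler0 add0r.
rewrite expmE (cauchy_product _ _ m1 (ltriv_majorized Z D)) ?mulr_ge0 ?nm_ge0 //.
congr msum; apply/funext => k.
rewrite -[Z * _ + _]/(power_diff Z D k.+1) power_diffE scaler_sumr.
rewrite (reindex_inj rev_ord_inj); apply: eq_bigr => i _ /=; rewrite subSS.
have ik : (i <= k)%N by rewrite -ltnS.
rewrite subKn // /ltriv_term -mscaleAl -mscaleAr !scalerA; congr (_ *: _).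
by rewrite mulrCA invf_fact_bin ?ltnS ?leq_subr // subSS subKn //; ring.
Qed.

(** What matters for a Lie algebra [g]: the operators given by series in [ad Z]
    preserve every subspace that [ad Z] preserves. *)
Section Stable.
Variables (g : {vspace 'M[R]_N}) (Z : 'M[R]_N).
Hypothesis gZ : forall D, D \in g -> lie_bracket Z D \in g.

Lemma ad_iter_stable D k : D \in g -> ad_iter Z D k \in g.
Proof. by move=> Dg; elim: k => [|k IHk] //=; apply: gZ. Qed.

Lemma ltriv_stable D : D \in g -> ltriv Z D \in g.
Proof.
move=> Dg; apply: msum_vspace (ltriv_majorized Z D) _ => k.
by rewrite rpredZ // ad_iter_stable.
Qed.

Lemma conj_stable X : X \in g -> expm (- Z) * X * expm Z \in g.
Proof.
move=> Xg; rewrite -mulrA mul_expmE mulrA expmNK mul1r.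
apply: msum_vspace (conj_majorized Z X) _ => k.
by rewrite rpredZ // ad_iter_stable.
Qed.
End Stable.

Lemma ad_iterB Z D D' k : ad_iter Z (D - D') k = ad_iter Z D k - ad_iter Z D' k.
Proof. by elim: k => //= k ->; rewrite linearB. Qed.

Lemma ltrivB Z D D' : ltriv Z (D - D') = ltriv Z D - ltriv Z D'.
Proof.
rewrite /ltriv -(msumB (ltriv_majorized Z D) (ltriv_majorized Z D')).
by congr msum; apply/funext => k; rewrite /ltriv_term ad_iterB scalerBr.
Qed.

Lemma nm_ltrivB Z D : nm Z <= log_radius / 4 ->
  nm (ltriv Z D - D) <= 2^-1 * nm D.
Proof.
move=> Zr; have r1 := @log_radius_le_half R.
have z0 := nm_ge0 Z; have z1 : 2 * nm Z <= 1 by lra.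
have tailmaj : majorized (2 * nm Z * nm D) 2 (fun k => ltriv_term Z D k.+1).
  move=> k; rewrite nmZ normrM normr_sign mul1r ger0_norm ?invr_ge0 //.
  rewrite mulrC /exp_coeff /= mulrA; apply: ler_pM; rewrite ?nm_ge0 ?invr_ge0 //.
    apply: le_trans (nm_ad_iter Z D k.+1) _; rewrite exprS -!mulrA ler_wpM2l //.
    rewrite ler_wpM2l ?nm_ge0 // [leRHS]mulrC ler_wpM2r ?nm_ge0 //.
    by apply: (@le_trans _ _ 1); rewrite ?exprn_ile1 ?exprn_ege1 ?mulr_ge0 ?nm_ge0 ?ler1n.
  rewrite lef_pV2 ?posrE ?ltr0n ?fact_gt0 // ler_nat.
  by apply: leq_fact; rewrite leqW.
rewrite /ltriv (msum_shift (ltriv_majorized Z D)).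
have -> : ltriv_term Z D 0 = D by rewrite /ltriv_term expr0 factS fact0 divr1 scale1r.
rewrite addrC addrA addNr add0r.
apply: le_trans (nm_msum_le _ tailmaj) _ => //.
have := @log_radius_expR R; set e := expR 2 => le.
have e0 : 0 < e by apply: expR_gt0.
have zD : nm Z * e <= log_radius / 4 * e by rewrite ler_wpM2r // ltW.
have := ler_wpM2r (nm_ge0 D) zD; have := nm_ge0 D; nra.
Qed.

Lemma ltriv_contraction Z D D' : nm Z <= log_radius / 4 ->
  nm ((ltriv Z D - D) - (ltriv Z D' - D')) <= 2^-1 * nm (D - D').
Proof.
move=> Zr; apply: le_trans (nm_ltrivB (D - D') Zr); rewrite ltrivB.
by rewrite le_eqVlt; apply/orP; left; apply/eqP; congr nm; apply/matrixP => i j; rewrite !mxE; ring.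
Qed.

Lemma ltriv_inj0 Z D : nm Z <= log_radius / 4 -> ltriv Z D = 0 -> D = 0.
Proof.
move=> Zr T0; have := nm_ltrivB D Zr; rewrite T0 sub0r nmN => D0.
by apply: nm_eq0; have := nm_ge0 D; lra.
Qed.

End DexpSeries.

(** * Uniqueness of the principal logarithm near the identity *)
Section CommonEigenvector.
Context {C : numClosedFieldType}.

(** The kernel of [F] is nonzero and stable under [X] and [Y], whose restrictions
    to it commute. *)
Lemma common_eigenvector_kermx n (X Y F : 'M[C]_n) :
  X *m Y = Y *m X -> X *m F = F *m X -> Y *m F = F *m Y ->
  F \notin unitmx ->
  exists v : 'rV[C]_n, exists x y, [/\ v != 0, v *m F = 0,
    v *m X = x *: v & v *m Y = y *: v].
Proof.
move=> XY XF YF nF; pose V := row_base (kermx F).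
have r0 : (0 < \rank (kermx F))%N.
  rewrite lt0n mxrank_eq0 kermx_eq0; apply: contra nF.
  by rewrite row_free_unit.
have VF : V *m F = 0 by apply/sub_kermxP; rewrite eq_row_base.
have Vfree : row_free V by apply: row_base_free.
have restr (A : 'M[C]_n) : A *m F = F *m A -> V *m A *m pinvmx V *m V = V *m A.
  move=> AF; apply: mulmxKpV; rewrite eq_row_base; apply/sub_kermxP.
  by rewrite -mulmxA AF mulmxA VF mul0mx.
pose X' := V *m X *m pinvmx V; pose Y' := V *m Y *m pinvmx V.
have X'V : X' *m V = V *m X by apply: restr.
have Y'V : Y' *m V = V *m Y by apply: restr.
have XY' : X' *m Y' = Y' *m X'.
  have l : X' *m Y' *m V = V *m X *m Y by rewrite -mulmxA Y'V mulmxA X'V.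
  have r : Y' *m X' *m V = V *m Y *m X by rewrite -mulmxA X'V mulmxA Y'V.
  apply: (row_free_inj Vfree); apply: etrans l (etrans _ (esym r)).
  by rewrite -!mulmxA XY.
have [v v0 /andP[/sub_rVP[x vX] /sub_rVP[y vY]]] := common_eigenvector2 r0 XY'.
exists (v *m V), x, y; split.
- apply: contra v0 => /eqP vV; apply/eqP; apply: (row_free_inj Vfree).
  by apply: etrans vV _; rewrite mul0mx.
- by rewrite -mulmxA VF mulmx0.
- by rewrite -mulmxA -X'V mulmxA vX scalemxAl.
- by rewrite -mulmxA -Y'V mulmxA vY scalemxAl.
Qed.

(** Compare the sums of the absolute values of the entries on both sides of
    [v *m A = a *: v]. *)
Lemma eigenvalue_norm_le (K : numFieldType) n (A : 'M[K]_n) (a e : K) :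
  eigenvalue A a -> (forall i j, `|A i j| <= e) -> `|a| <= n%:R * e.
Proof.
move=> /eigenvalueP[v vA v0] Ae.
have vpos : 0 < \sum_j `|v 0 j|.
  rewrite lt_def sumr_ge0 // andbT; apply: contra v0 => /eqP v0.
  apply/eqP/rowP => j; rewrite mxE; apply/eqP; rewrite -normr_eq0.
  move/eqP: v0; rewrite psumr_eq0 // => /allP/(_ j).
  by rewrite mem_index_enum => /(_ isT).
rewrite -(ler_pM2r vpos) mulr_sumr.
apply: le_trans (_ : \sum_j \sum_i `|v 0 i| * e <= _).
  apply: ler_sum => j _; rewrite -normrM.
  have -> : a * v 0 j = (v *m A) 0 j by rewrite vA mxE.
  rewrite mxE; apply: le_trans (ler_norm_sum _ _ _) _.
  by apply: ler_sum => i _; rewrite normrM ler_wpM2l.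
by rewrite -mulr_suml sumr_const card_ord -[leLHS]mulr_natl -[leRHS]mulrA [_ * e]mulrC.
Qed.
End CommonEigenvector.

Section ComplexExponential.
Context {R : realType}.
Implicit Types (a b c d p q : R).

(** Multiplication by the complex number [a + i b], as a real matrix.  The
    exponential of a complex number is thus read on real matrices, where the series
    of cosine and sine are available. *)
Definition cmul_mx a b : 'M[R]_2 :=
  \matrix_(i, j) (if i == j then a else if (i < j)%N then - b else b).

Lemma cmul_mxM a b c d :
  cmul_mx a b * cmul_mx c d = cmul_mx (a * c - b * d) (a * d + b * c).
Proof.
apply/matrixP => i j; rewrite !mxE !big_ord_recl big_ord0 !mxE.
by case: i => [[|[|//]] ?]; case: j => [[|[|//]] ?]; rewrite /=; ring.
Qed.

Lemma cmul_mxX p q k : exists a b, cmul_mx p q ^+ k = cmul_mx a b.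
Proof.
elim: k => [|k [a [b IHk]]].
  exists 1, 0; apply/matrixP => i j; rewrite expr0 !mxE oppr0.
  by case: eqP => //; case: ifP.
by rewrite exprSr IHk cmul_mxM; do 2!eexists.
Qed.

Lemma cmul_mxX_rotation q k : cmul_mx 0 q ^+ k =
  cmul_mx ((~~ odd k)%:R * (-1) ^+ k./2 * q ^+ k)
          ((odd k)%:R * (-1) ^+ k.-1./2 * q ^+ k).
Proof.
elim: k => [|k IHk].
  apply/matrixP => i j; rewrite expr0 !mxE /= expr0 !mul1r !mul0r oppr0.
  by case: eqP => //; case: ifP.
rewrite exprSr IHk cmul_mxM !mulr0 sub0r addr0 oddS; congr cmul_mx.
  rewrite negbK [in RHS]exprSr; case: (boolP (odd k)) => [ok|_]; last by rewrite !mul0r oppr0.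
  have -> : k.+1./2 = k.-1./2.+1 by case: k ok {IHk}.
  by rewrite exprSr; ring.
by rewrite /= [in RHS]exprSr; case: (odd k) => /=; ring.
Qed.

Lemma expm_coord N (M : 'M[R]_N) i j :
  series (fun k => exp_term M k i j) @ \oo --> expm M i j.
Proof.
have /majorized_cvg h := exp_term_majorized (lexx (nm M)).
have := cvg_comp (series (exp_term M)) (fun A : 'M[R]_N => A i j) h.
move=> /(_ _ (@coord_continuous R N N i j _)).
have -> : (fun A : 'M[R]_N => A i j) \o series (exp_term M) =
    series (fun k => exp_term M k i j).
  by apply/funext => n; rewrite /= !seriesEnat /= summxE.
exact.
Qed.

Lemma expm_scalar N p : expm (p%:M : 'M[R]_N) = (expR p)%:M.
Proof.
apply/matrixP => i j; rewrite mxE.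
have H := @expm_coord N p%:M i j.
have E k : exp_term (p%:M : 'M[R]_N) k i j = exp_coeff p k *+ (i == j).
  rewrite /exp_term; have -> : (p%:M : 'M[R]_N) ^+ k = (p ^+ k)%:M.
    elim: k => [|k IHk]; first by rewrite !expr0.
    by rewrite !exprS IHk -mulmxE -scalar_mxM.
  by rewrite !mxE mulrnAr mulrC.
apply: (cvg_unique _ H); first exact: Rhausdorff.
rewrite (_ : (fun k => _) = (fun k => exp_coeff p k *+ (i == j))); last by apply/funext.
case: eqP => _ /=.
  exact: is_cvg_series_exp_coeff.
rewrite mulr0n; apply: cvg_near_cst; near=> n.
by rewrite seriesEnat /= big1.
Unshelve. all: by end_near. Qed.

Lemma expm_rotation q : expm (cmul_mx 0 q) = cmul_mx (cos q) (sin q).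
Proof.
have E k : exp_term (cmul_mx 0 q) k = cmul_mx (cos_coeff q k) (sin_coeff q k).
  rewrite /exp_term cmul_mxX_rotation; apply/matrixP => i j; rewrite !mxE.
  rewrite /cos_coeff /sin_coeff /= -exprnP.
  by case: ifP => _; [|case: ifP => _]; rewrite 1?mulrN mulrC.
have Hc : series (cos_coeff q) @ \oo --> cos q.
  by rewrite cos.unlock; apply: is_cvg_series_cos_coeff.
have Hs : series (sin_coeff q) @ \oo --> sin q.
  by rewrite sin.unlock; apply: is_cvg_series_sin_coeff.
apply/matrixP => i j; rewrite mxE.
have H := @expm_coord _ (cmul_mx 0 q) i j.
apply: (cvg_unique _ H); first exact: Rhausdorff.
rewrite (_ : (fun k => _) = (fun k => cmul_mx (cos_coeff q k) (sin_coeff q k) i j)); last first.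
  by apply/funext => k; rewrite E.
case: (boolP (i == j)) => ij.
  by rewrite (_ : (fun k => _) = cos_coeff q) //; apply/funext => k; rewrite mxE ij.
case: (boolP (i < j)%N) => ltij.
  rewrite (_ : (fun k => _) = - sin_coeff q); last first.
    by apply/funext => k; rewrite mxE (negPf ij) ltij.
  rewrite (_ : series _ = - series (sin_coeff q)); first exact: cvgN.
  by apply/funext => n; rewrite fctE !seriesEnat /= sumrN.
rewrite (_ : (fun k => _) = sin_coeff q) //; apply/funext => k.
by rewrite mxE (negPf ij) (negPf ltij).
Qed.

Lemma expm_cmul_mx p q :
  expm (cmul_mx p q) = cmul_mx (expR p * cos q) (expR p * sin q).
Proof.
have -> : cmul_mx p q = p%:M + cmul_mx 0 q.
  apply/matrixP => i j; rewrite !mxE; case: ifP => _; first by rewrite addr0.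
  by rewrite add0r.
rewrite expmD; last by rewrite /GRing.comm -!mulmxE scalar_mxC.
rewrite expm_scalar expm_rotation; apply/matrixP => i j.
rewrite [LHS](_ : _ = (expR p *: cmul_mx (cos q) (sin q)) i j); last by rewrite -mul_scalar_mx.
by rewrite !mxE; case: ifP => _ //; case: ifP => _ //; rewrite mulrN.
Qed.

(** The hypotheses say that the rows of [U + i W] are eigenvectors of [Z] for
    [p + i q].  By induction [Z ^+ k] acts on the pair [(U, W)] through
    [(p + i q) ^ k], and so does [expm Z] through [exp (p + i q)]. *)
Lemma expm_eigen N (U W Z : 'M[R]_N) p q :
  U * Z = p *: U - q *: W -> W * Z = q *: U + p *: W ->
  U * expm Z = (expR p * cos q) *: U - (expR p * sin q) *: W /\
  W * expm Z = (expR p * sin q) *: U + (expR p * cos q) *: W.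
Proof.
move=> UZ WZ; set M := cmul_mx p q.
have H k : U * Z ^+ k = ((M ^+ k) 0 0) *: U - ((M ^+ k) 1 0) *: W /\
           W * Z ^+ k = ((M ^+ k) 1 0) *: U + ((M ^+ k) 0 0) *: W.
  elim: k => [|k [IHU IHW]].
    by rewrite !expr0 !mulr1 !mxE /= scale1r !scale0r subr0 add0r scale1r.
  have [a [b E]] := cmul_mxX p q k.
  have E1 : M ^+ k.+1 = cmul_mx (a * p - b * q) (a * q + b * p) by rewrite exprSr E cmul_mxM.
  rewrite !exprSr !mulrA IHU IHW -!exprSr E1 /M E !mxE /= mulrBl mulrDl -!mscaleAl UZ WZ.
  by split; apply/matrixP => i j; rewrite !mxE; ring.
have maj := exp_term_majorized (lexx (nm Z)).
have cE : series (fun k => exp_term M k 0 0) @ \oo --> expR p * cos q.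
  by have := @expm_coord _ M 0 0; rewrite expm_cmul_mx mxE.
have sE : series (fun k => exp_term M k 1 0) @ \oo --> expR p * sin q.
  by have := @expm_coord _ M 1 0; rewrite expm_cmul_mx mxE.
split; rewrite expmE (msum_Lmul _ maj); apply: msumP.
  rewrite (_ : series _ = (fun n => series (fun k => exp_term M k 0 0) n *: U
     - series (fun k => exp_term M k 1 0) n *: W)).
    by apply: cvgB; apply: cvgZ => //; apply: cvg_cst.
  apply/funext => n; rewrite !seriesEnat /= !scaler_suml -sumrB; apply: eq_bigr => k _.
  by rewrite /exp_term -mscaleAr (H k).1 !mxE scalerBr !scalerA.
rewrite (_ : series _ = (fun n => series (fun k => exp_term M k 1 0) n *: U
   + series (fun k => exp_term M k 0 0) n *: W)).
  by apply: cvgD; apply: cvgZ => //; apply: cvg_cst.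
apply/funext => n; rewrite !seriesEnat /= !scaler_suml -big_split; apply: eq_bigr => k _.
by rewrite /exp_term -mscaleAr (H k).2 !mxE scalerDr !scalerA.
Qed.

(** The logarithms of [1] are the multiples of [2 i pi]. *)
Lemma expm1_eigen0 N (U W Z : 'M[R]_N) p q :
  U * Z = p *: U - q *: W -> W * Z = q *: U + p *: W ->
  expm Z = 1 -> (U != 0) || (W != 0) -> `|q| < 2 * pi -> p = 0 /\ q = 0.
Proof.
move=> UZ WZ Z1 UW qpi; have [] := expm_eigen UZ WZ; rewrite Z1 !mulr1.
set c := expR p * cos q; set s := expR p * sin q => UE WE.
(* this is the square of the modulus of exp (p + i q) - 1 *)
have cs : (c - 1) ^+ 2 + s ^+ 2 = 0.
  apply/eqP; apply: contraLR UW => cs; rewrite negb_or !negbK.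
  have EU : ((c - 1) ^+ 2 + s ^+ 2) *: U = 0.
    have -> : ((c - 1) ^+ 2 + s ^+ 2) *: U =
      (c - 1) *: (c *: U - s *: W - U) + s *: (s *: U + c *: W - W).
      by apply/matrixP => i j; rewrite !mxE; ring.
    by rewrite -UE -WE !subrr !scaler0 addr0.
  have EW : ((c - 1) ^+ 2 + s ^+ 2) *: W = 0.
    have -> : ((c - 1) ^+ 2 + s ^+ 2) *: W =
      (c - 1) *: (s *: U + c *: W - W) - s *: (c *: U - s *: W - U).
      by apply/matrixP => i j; rewrite !mxE; ring.
    by rewrite -UE -WE !subrr !scaler0 subr0.
  move/eqP: EU; move/eqP: EW; rewrite !scaler_eq0 (negPf cs) /= => -> ->.
  by [].
have c1 : c = 1 by nra.
have s0 : s = 0 by nra.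
have ep := expR_gt0 p.
have sq0 : sin q = 0 by move/eqP: s0; rewrite mulf_eq0 gt_eqF //= => /eqP.
have cq : cos q = 1.
  have := cos2Dsin2 q; rewrite sq0; move: c1; rewrite /c => c1.
  have : 0 < cos q by rewrite -(pmulr_rgt0 _ ep) c1.
  by nra.
have p0 : p = 0.
  by apply: expR_inj; rewrite expR0; move: c1; rewrite /c cq mulr1.
split=> //.
(* from [cos q = 1 - 2 sin^2 (q / 2)]; now [q / 2] lies in ]- pi, pi[ *)
have h : sin `|q / 2| = 0.
  have := cos_mulr2n (q / 2); rewrite -[_ *+ 2]mulr_natr divfK // cq.
  have := cos2Dsin2 (q / 2); rewrite -[cos _ ^+ 2]/(_ * _) => e1 e2.
  have s2 : sin (q / 2) = 0 by nra.
  by have [h|h] := leP 0 (q / 2); [rewrite ger0_norm|rewrite ltr0_norm // sinN s2 oppr0].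
have [//|q0] := eqVneq q 0.
have : 0 < `|q / 2| < pi.
  rewrite normr_gt0 mulf_neq0 ?invr_neq0 //= normrM (ger0_norm (_ : 0 <= 2^-1)) ?invr_ge0 //.
  by rewrite ltr_pdivrMr // mulrC.
by move=> /sin_gt0_pi; rewrite h ltxx.
Qed.

End ComplexExponential.

Section PrincipalLogarithm.
Context {R : realType} {N : nat}.
Implicit Types (A X Y Z F : 'M[R]_N).

(** [X] commutes with [exp X = exp Y], so the differential of [exp] at [Y] kills
    [[Y, X]] by [bracketX]; for small [Y] this differential is injective. *)
Lemma expm_eq_comm X Y : nm Y <= log_radius / 4 -> expm X = expm Y ->
  GRing.comm X Y.
Proof.
move=> Yr XY; have r1 := @log_radius_le_half R.
have Y1 : nm Y <= 1 by lra.
have XeY : X * expm Y = expm Y * X.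
  by rewrite -XY; apply: comm_expm; apply: commr_refl.
suff W0 : lie_bracket Y X = 0.
  by apply/esym/eqP; rewrite -subr_eq0; apply/eqP.
apply: (ltriv_inj0 Yr).
rewrite -[LHS]mul1r -(expmNK Y) -mulrA -dexpE //.
rewrite (_ : dexp _ _ = 0) ?mulr0 //.
have maj := exp_term_majorized (lexx (nm Y)).
have majR : majorized (N.+1%:R * nm X) (nm Y) (fun k => exp_term Y k * X).
  move=> k; apply: le_trans (nmM _ _) _.
  by rewrite mulrAC ler_wpM2r ?nm_ge0.
have majL : majorized (N.+1%:R * nm X) (nm Y) (fun k => X * exp_term Y k).
  move=> k; apply: le_trans (nmM _ _) _; rewrite mulrC.
  by rewrite mulrAC ler_wpM2r ?nm_ge0.
rewrite -(subrr (expm Y * X)) -{2}XeY !expmE (msum_Lmul _ maj) (msum_Rmul _ maj).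
rewrite -(msumB majR majL) /dexp; congr msum; apply/funext => k.
by rewrite -bracketX scalerBr mscaleAl mscaleAr.
Qed.

Definition phi_term Z k : 'M[R]_N := ((k.+1)`!%:R : R)^-1 *: Z ^+ k.

Lemma phi_majorized Z : majorized N.+1%:R (nm Z) (phi_term Z).
Proof.
move=> k; apply: le_trans (exp_term_majorized (lexx (nm Z)) k).
rewrite !nmZ ler_wpM2r ?nm_ge0 // !ger0_norm ?invr_ge0 //.
by rewrite lef_pV2 ?posrE ?ltr0n ?fact_gt0 // ler_nat factS leq_pmull.
Qed.

(** The value at [Z] of the entire function [(e^z - 1) / z]. *)
Definition phi Z : 'M[R]_N := msum (phi_term Z).

Lemma mul_phi Z : Z * phi Z = expm Z - 1.
Proof.
have maj := exp_term_majorized (lexx (nm Z)).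
rewrite expmE (msum_shift maj) /phi (msum_Lmul _ (phi_majorized Z)).
have -> : exp_term Z 0 = 1 by rewrite /exp_term expr0 fact0 invr1 scale1r.
rewrite addrC addKr; congr msum; apply/funext => k.
by rewrite /phi_term -mscaleAr -exprS.
Qed.

Lemma comm_phi A Z : GRing.comm A Z -> GRing.comm A (phi Z).
Proof.
move=> AZ; rewrite /GRing.comm (msum_Lmul _ (phi_majorized Z)) (msum_Rmul _ (phi_majorized Z)).
congr msum; apply/funext => k; rewrite /phi_term -mscaleAr -mscaleAl.
by congr (_ *: _); apply: commrX.
Qed.

Lemma mul_phi0 U Z : U * Z = 0 -> U * phi Z = U.
Proof.
move=> UZ; rewrite (msum_Lmul _ (phi_majorized Z)) (@msum_fin _ _ 1).
  by rewrite big_ord1 /phi_term expr0 factS fact0 invr1 scale1r mulr1.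
by case=> // k _; rewrite /phi_term -mscaleAr exprS mulrA UZ mul0r scaler0.
Qed.

Local Notation cpx := (map_mx (real_complex R)).

Lemma Re_mulmx m n p (V : 'M[R[i]]_(m, n)) (A : 'M[R]_(n, p)) :
  map_mx (@complex.Re R) (V *m (cpx A)) = map_mx (@complex.Re R) V *m A.
Proof.
apply/matrixP => i j; rewrite !mxE.
rewrite (big_morph (@complex.Re R) (id1 := 0) (op1 := +%R)) //; last by case=> [? ?] [].
by apply: eq_bigr => k _; rewrite !mxE; case: (V i k) => a b /=; rewrite mulr0 subr0.
Qed.

Lemma Im_mulmx m n p (V : 'M[R[i]]_(m, n)) (A : 'M[R]_(n, p)) :
  map_mx (@complex.Im R) (V *m (cpx A)) = map_mx (@complex.Im R) V *m A.
Proof.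
apply/matrixP => i j; rewrite !mxE.
rewrite (big_morph (@complex.Im R) (id1 := 0) (op1 := +%R)) //; last by case=> [? ?] [].
by apply: eq_bigr => k _; rewrite !mxE; case: (V i k) => a b /=; rewrite mulr0 add0r.
Qed.

Lemma Im_le_norm (z : R[i]) b : `|z| <= (b%:C)%C -> `|complex.Im z| <= b.
Proof.
rewrite normc_def lecR; apply: le_trans.
by rewrite -sqrtr_sqr ler_wsqrtr // lerDr sqr_ge0.
Qed.

Lemma eigenvalue_Im_le X (z : R[i]) :
  eigenvalue (cpx X) z -> `|complex.Im z| <= nm X.
Proof.
move=> /eigenvalue_norm_le zX; apply: Im_le_norm.
apply: le_trans (zX (`|X|%:C)%C _) _.
  by move=> i j; rewrite mxE normc_def /= expr0n addr0 sqrtr_sqr lecR coord_le_norm.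
rewrite -[N%:R](rmorph_nat (real_complex R)) -rmorphM lecR nm.unlock.
by rewrite ler_wpM2r // ler_nat.
Qed.

(** With [Z := X - Y] one has [expm Z = 1], that is [Z * phi Z = 0], and it is
    enough that [phi Z] be invertible.  Otherwise [X] and [Y] have a common
    eigenvector in its kernel, for the eigenvalues [x] and [y].  There [Z] acts as
    [x - y], which exponentiates to [1] and has an imaginary part smaller than
    [2 pi]; hence [x = y], and [phi Z] acts as [phi 0 = 1], a contradiction. *)
Lemma principal_log_unique X Y : nm Y <= log_radius / 4 ->
  is_principal_log (expm Y) X -> X = Y.
Proof.
move=> Yr [XY Xstrip]; have r1 := @log_radius_le_half R.
have cXY := expm_eq_comm Yr XY.
pose Z := X - Y.
have Z1 : expm Z = 1.
  by rewrite expmD ?XY ?expmKN //; apply: commrN.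
have ZF : Z * phi Z = 0 by rewrite mul_phi Z1 subrr.
have cXZ : GRing.comm X Z by apply: commrB => //; apply: commr_refl.
have cYZ : GRing.comm Y Z by apply: commrB; [apply: commr_sym|apply: commr_refl].
have [uF|nF] := boolP (phi Z \in unitmx).
  have Z0 : Z = 0 by rewrite -[Z](mulmxK uF) [Z *m _]ZF mul0mx.
  by apply/eqP; rewrite -subr_eq0 -/Z Z0.
exfalso.
have mapC (A B : 'M[R]_N) : A * B = B * A -> (cpx A) *m (cpx B) = (cpx B) *m (cpx A).
  by move=> AB; rewrite -!map_mxM; congr map_mx.
have nFC : (cpx (phi Z)) \notin unitmx by rewrite map_unitmx.
have [v [x [y [v0 vF vX vY]]]] := common_eigenvector_kermx (mapC _ _ cXY)
  (mapC _ _ (comm_phi cXZ)) (mapC _ _ (comm_phi cYZ)) nFC.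
have xpi : `|complex.Im x| < pi by apply: Xstrip; apply/eigenvalueP; exists v.
have ypi : `|complex.Im y| < pi.
  apply: le_lt_trans (eigenvalue_Im_le (X := Y) _) _; first by apply/eigenvalueP; exists v.
  have := pi_ge2 R; lra.
(* square matrices with equal rows stand for the vector [v], so that ring
   multiplication applies *)
pose V := \matrix_(i < N, j < N) v 0 j.
have rowV i : row i V = v by apply/rowP => j; rewrite !mxE.
have VZ : V *m (cpx Z) = (x - y) *: V.
  apply/row_matrixP => i; rewrite row_mul linearZ /= !rowV /Z map_mxB mulmxBr vX vY.
  by rewrite scalerBl.
have VF : V *m (cpx (phi Z)) = 0.
  by apply/row_matrixP => i; rewrite row_mul rowV vF linear0.
pose U := map_mx (@complex.Re R) V; pose W := map_mx (@complex.Im R) V.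
pose p := complex.Re (x - y); pose q := complex.Im (x - y).
have UZ : U * Z = p *: U - q *: W.
  rewrite -mulmxE -Re_mulmx VZ; apply/matrixP => i j; rewrite !mxE /p /q.
  by case: (x - y) => a b; case: (v 0 j) => c d.
have WZ : W * Z = q *: U + p *: W.
  rewrite -mulmxE -Im_mulmx VZ; apply/matrixP => i j; rewrite !mxE /p /q.
  by case: (x - y) => a b; case: (v 0 j) => c d /=; rewrite addrC.
have UW0 : (U != 0) || (W != 0).
  rewrite -negb_and; apply: contra v0 => /andP[/eqP U0 /eqP W0].
  apply/eqP/rowP => j; have := congr1 (fun M : 'M[R]_N => M j j) U0.
  have := congr1 (fun M : 'M[R]_N => M j j) W0; rewrite !mxE.
  by case: (v 0 j) => a b /= -> ->.
have qpi : `|q| < 2 * pi.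
  have -> : q = complex.Im x - complex.Im y by rewrite /q; case: (x) => ? ?; case: (y) => ? ?.
  by apply: le_lt_trans (ler_normB _ _) _; lra.
have [p0 q0] := expm1_eigen0 UZ WZ Z1 UW0 qpi.
have UF : U * phi Z = 0.
  by rewrite -mulmxE -Re_mulmx VF; apply/matrixP => i j; rewrite !mxE.
have WF : W * phi Z = 0.
  by rewrite -mulmxE -Im_mulmx VF; apply/matrixP => i j; rewrite !mxE.
have U0 : U = 0 by rewrite -UF mul_phi0 // UZ p0 q0 !scale0r subr0.
have W0 : W = 0 by rewrite -WF mul_phi0 // WZ p0 q0 !scale0r addr0.
by move: UW0; rewrite U0 W0 eqxx.
Qed.

Lemma small_is_principal_log Y : nm Y <= log_radius / 4 ->
  is_principal_log (expm Y) Y.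
Proof.
move=> Yr; split=> // z /eigenvalue_Im_le; have r1 := @log_radius_le_half R.
have := pi_ge2 R; lra.
Qed.

Lemma logm_expm Y : nm Y <= log_radius / 4 -> logm (expm Y) = Y.
Proof.
move=> Yr; apply: xget_unique; first exact: small_is_principal_log.
by move=> X; apply: principal_log_unique.
Qed.

Lemma near1_principal_log_domain A : nm (A - 1) < 1 -> principal_log_domain A.
Proof.
move=> A1 a a0; apply/negP => /eigenvalueP[v vA v0].
have /eigenvalue_norm_le : eigenvalue (A - 1) (a - 1).
  by apply/eigenvalueP; exists v => //; rewrite mulmxBr vA scalerBl scale1r mulmx1.
move=> /(_ `|A - 1|) H; have := H (fun i j => coord_le_norm (A - 1) i j).
move: A1; rewrite nm.unlock => A1 {}H.
have : N%:R * `|A - 1| <= N.+1%:R * `|A - 1| by rewrite ler_wpM2r // ler_nat.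
rewrite ler0_norm in H; lra.
Qed.

End PrincipalLogarithm.

(** * Logarithms of products of exponentials in a Lie algebra *)
Section BakerCampbellHausdorff.
Context {R : realType} {N : nat}.
Implicit Types (D U W Y Z : 'M[R]_N).

Lemma nm_expm_le1 W : nm W <= 1 -> nm (expm W) <= N.+1%:R * expR 1.
Proof. exact: nm_expm. Qed.

Lemma nm_expm_sub1 Y : nm Y <= 1 -> nm (expm Y - 1) <= expR 2 * nm Y.
Proof.
move=> Y1; rewrite exp_tail1E addrAC subrr add0r.
by have := nm_exp_tail 0 (lexx (nm Y)) Y1; rewrite expr0 mul1r mulrC.
Qed.

(** One step of Euler's method for [W' = ltriv_W^-1 U], the equation satisfied by
    [W = log (exp Y * exp (h U))]: the increment solves [ltriv W D = U], so that
    [exp (W + D)] and [exp W * exp U] agree to first order. *)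
Lemma bch_step (g : {vspace 'M[R]_N}) W U :
  (forall D, D \in g -> lie_bracket W D \in g) -> U \in g ->
  nm W <= log_radius / 4 -> nm U <= 4^-1 ->
  exists D, [/\ D \in g, nm D <= 2 * nm U &
    nm (expm (W + D) - expm W * expm U)
      <= (4 + N.+1%:R * expR 1) * expR 2 * nm U ^+ 2].
Proof.
move=> gW Ug Wr U4; have r1 := @log_radius_le_half R.
have W1 : nm W <= 1 by lra.
have [|||||D [Dg DU DE]] :=
  @near_identity_solve R N g (fun D => ltriv W D - D) (2 * nm U) U.
- by have := ltrivB W 0 0; rewrite !subr0 subrr.
- by move=> D Dg _; rewrite rpredB // ltriv_stable.
- by move=> D D' _ _; apply: ltriv_contraction.
- exact: Ug.
- by have := nm_ge0 U; lra.
exists D; split=> //.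
have TD : ltriv W D = U by rewrite -DE addrC subrK.
have WD1 : nm (W + D) <= 1 by have := nmD W D; lra.
have -> : expm (W + D) - expm W * expm U =
    (expm (W + D) - expm W - dexp W D) - expm W * exp_tail 2 U.
  rewrite dexpE // TD (exp_tail2E U) !mulrDr mulr1.
  move: (_ * _) (_ * _) => a b; apply/matrixP => i j; rewrite !mxE; ring.
have -> : (4 + N.+1%:R * expR 1) * expR 2 * nm U ^+ 2 =
    4 * expR 2 * nm U ^+ 2 + N.+1%:R * expR 1 * expR 2 * nm U ^+ 2.
  by move: (N.+1%:R) (expR 1) => x y; ring.
apply: le_trans (nmB _ _) (lerD _ _).
  apply: le_trans (expm_dexp W1 WD1) _.
  rewrite [leRHS]mulrAC ler_wpM2r ?expR_ge0 //.
  have -> : 4 * nm U ^+ 2 = (2 * nm U) ^+ 2 by ring.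
  by rewrite lerXn2r ?nnegrE ?mulr_ge0 ?nm_ge0.
apply: le_trans (nmM _ _) _; rewrite -mulrA.
apply: ler_pM; rewrite ?nm_ge0 //; first exact: nm_expm_le1.
apply: le_trans (nm_exp_tail 1 (lexx (nm U)) _) _; first by lra.
by rewrite expr1 mulrC expr2.
Qed.

(** Along the exact flow [exp W * exp (- h U)] is constantly [exp Y]; each of the
    [n.+1] steps moves it by [O(1 / n ^ 2)]. *)
Lemma bch_euler (g : {vspace 'M[R]_N}) Y U (n : nat) :
  lie_subalgebra g -> Y \in g -> U \in g -> nm Y + 2 * nm U <= log_radius / 4 ->
  forall i, (i <= n.+1)%N -> exists W, [/\ W \in g,
    nm W <= nm Y + 2 * nm U * (i%:R / n.+1%:R) &
    nm (expm W * expm (- (i%:R / n.+1%:R) *: U) - expm Y) <=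
      i%:R * ((4 + N.+1%:R * expR 1) * expR 2 * (N.+1%:R * expR 1) / n.+1%:R ^+ 2)].
Proof.
move=> glie Yg Ug YU; have r1 := @log_radius_le_half R.
have U0 := nm_ge0 U; have Y0 := nm_ge0 Y.
have n0 : 0 < n.+1%:R :> R by rewrite ltr0n.
set h : R := n.+1%:R^-1; have h0 : 0 < h by rewrite invr_gt0.
have h1 : h <= 1 by rewrite invf_le1 // ler1n.
elim=> [_|i IHi ltin].
  exists Y; split=> //; first by rewrite mul0r mulr0 addr0.
  by rewrite mul0r oppr0 scale0r expm0 mulr1 subrr nm0 mul0r.
have [W [Wg Wle WE]] := IHi (ltnW ltin).
have ih : i%:R * h <= 1 by rewrite ler_pdivrMr // mul1r ler_nat ltnW.
have i1h : i.+1%:R * h <= 1 by rewrite ler_pdivrMr // mul1r ler_nat.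
have ihE : i.+1%:R * h = i%:R * h + h by rewrite -addn1 natrD mulrDl mul1r.
have Wr : nm W <= log_radius / 4.
  have : 2 * nm U * (i%:R * h) <= 2 * nm U * 1 by rewrite ler_wpM2l ?mulr_ge0.
  lra.
have hU : nm (h *: U) = h * nm U by rewrite nmZ gtr0_norm.
have hUle : h * nm U <= nm U by rewrite ler_piMl.
have [||||D [Dg DU DE]] := @bch_step g W (h *: U).
- by move=> D Dg; apply: glie.
- by rewrite rpredZ.
- exact: Wr.
- by rewrite hU; lra.
exists (W + D); split; first by rewrite rpredD.
  by apply: le_trans (nmD _ _) _; rewrite hU in DU; rewrite ihE; lra.
set K := N.+1%:R * expR 1 in DE *; set c := (4 + K) * expR 2 in DE *.
have K0 : 0 <= K by rewrite mulr_ge0 ?expR_ge0.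
have c0 : 0 <= c by rewrite mulr_ge0 ?expR_ge0 // addr_ge0.
set P := expm (- (i.+1%:R * h) *: U).
(* multiplying the local error by [P] on the right makes it telescope *)
have PE : expm (- (i%:R * h) *: U) = expm (h *: U) * P.
  have -> : - (i%:R * h) *: U = h *: U + - (i.+1%:R * h) *: U.
    by rewrite -scalerDl ihE opprD addrCA subrr addr0.
  by rewrite /P expmD // /GRing.comm -!mscaleAl -!mscaleAr !scalerA mulrC.
have PK : nm P <= K.
  apply: nm_expm_le1; rewrite nmZ normrN ger0_norm ?mulr_ge0 ?(ltW h0) //.
  have : i.+1%:R * h * nm U <= 1 * nm U by rewrite ler_wpM2r.
  lra.
have -> : expm (W + D) * P - expm Y =
   (expm (W + D) - expm W * expm (h *: U)) * P + (expm W * expm (- (i%:R * h) *: U) - expm Y).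
  by rewrite PE mulrBl -mulrA addrA subrK.
set X := c * K / n.+1%:R ^+ 2 in WE *.
have -> : i.+1%:R * X = X + i%:R * X by rewrite -addn1 natrD mulrDl mul1r addrC.
apply: le_trans (nmD _ _) (lerD _ WE); rewrite /X.
apply: le_trans (nmM _ _) _; rewrite -exprVn -/h.
have -> : c * K * h ^+ 2 = (c * h ^+ 2) * K by ring.
apply: ler_pM; rewrite ?nm_ge0 //; apply: le_trans DE _.
rewrite ler_wpM2l // hU lerXn2r ?nnegrE ?mulr_ge0 ?(ltW h0) //.
by rewrite ler_piMr ?(ltW h0) //; lra.
Qed.

End BakerCampbellHausdorff.

Section GroupLikeProducts.
Context {R : realType} {N : nat}.
Implicit Types (D U W Y Z : 'M[R]_N).

Definition bch_radius : R := log_radius / (8 * expR 2).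

Lemma bch_radius_gt0 : 0 < bch_radius.
Proof. by rewrite divr_gt0 ?log_radius_gt0 // mulr_gt0 ?expR_gt0. Qed.

(** The logarithm [Z] exists by local inversion, and the Euler approximations, which
    lie in [g], converge to it because the logarithm is Lipschitz. *)
Lemma bch_mem (g : {vspace 'M[R]_N}) Y U :
  lie_subalgebra g -> Y \in g -> U \in g -> nm Y + nm U <= bch_radius ->
  exists Z, [/\ Z \in g, nm Z <= 4 * expR 2 * (nm Y + nm U) &
    expm Z = expm Y * expm U].
Proof.
move=> glie Yg Ug YU; have r1 := @log_radius_le_half R.
have r0 := @log_radius_gt0 R.
have U0 := nm_ge0 U; have Y0 := nm_ge0 Y; have e0 : 0 < expR 2 :> R := expR_gt0 _.
have e1 : 1 <= expR 2 :> R by have := expR_ge1Dx (2 : R); lra.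
have YUe : expR 2 * (nm Y + nm U) <= log_radius / 8.
  move: YU; rewrite /bch_radius ler_pdivlMr ?mulr_gt0 //; lra.
have YU8 : nm Y + nm U <= log_radius / 8.
  by apply: le_trans YUe; rewrite ler_peMl // addr_ge0.
have A1 : nm (expm Y * expm U - 1) <= 2 * expR 2 * (nm Y + nm U).
  have -> : expm Y * expm U - 1 = (expm Y - 1) + (expm U - 1) + (expm Y - 1) * (expm U - 1).
    rewrite mulrBr mulr1 mulrBl mul1r; move: (_ * _) => a.
    by apply/matrixP => i j; rewrite !mxE; ring.
  apply: le_trans (nmD _ _) _; apply: le_trans (lerD (nmD _ _) (nmM _ _)) _.
  have Y1 : nm (expm Y - 1) <= expR 2 * nm Y by apply: nm_expm_sub1; lra.
  have U1 : nm (expm U - 1) <= expR 2 * nm U by apply: nm_expm_sub1; lra.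
  have U2 : nm (expm U - 1) <= 1.
    apply: le_trans U1 _; apply: (@le_trans _ _ (log_radius / 8)); last by lra.
    by apply: le_trans YUe; rewrite ler_wpM2l ?(ltW e0) // lerDr.
  have YY : nm (expm Y - 1) * nm (expm U - 1) <= nm (expm Y - 1).
    by rewrite ler_piMr ?nm_ge0.
  have := mulr_ge0 (ltW e0) U0.
  move: (nm (expm Y - 1)) (nm (expm U - 1)) Y1 U1 YY {U2 YUe YU8} => a c.
  by move: (expR 2) => e; lra.
have [|Z ZA ZE] := @local_log_exists R N (expm Y * expm U); first by lra.
exists Z; split=> //; last by apply: le_trans ZA _; lra.
set K : R := N.+1%:R * expR 1; set q : R := (4 + K) * expR 2 * K.
pose c : R := 2 * q * K.
have Weuler n : exists W, W \in g /\ nm (W - Z) <= c * harmonic n.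
  have [|W [Wg Wle WE]] := @bch_euler R N g Y U n glie Yg Ug _ _ (leqnn n.+1); first by lra.
  exists W; split=> //.
  have nn1 : n.+1%:R / n.+1%:R = 1 :> R by rewrite divff ?pnatr_eq0.
  rewrite nn1 mulr1 in Wle; rewrite nn1 scaleN1r in WE.
  apply: le_trans (expm_bilipschitz _ _) _; [lra|lra|].
  have -> : expm W - expm Z = (expm W * expm (- U) - expm Y) * expm U.
    by rewrite ZE mulrBl -(mulrA (expm W)) (expmNK U) mulr1.
  have -> : c * harmonic n = 2 * (q / n.+1%:R * K) by rewrite /c /harmonic /=; ring.
  rewrite ler_wpM2l //; apply: le_trans (nmM _ _) _.
  apply: ler_pM; rewrite ?nm_ge0 //; last by apply: nm_expm_le1; lra.
  apply: le_trans WE _; rewrite le_eqVlt; apply/orP; left; apply/eqP.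
  by rewrite -/K -/q expr2 invfM mulrCA (mulrA n.+1%:R) nn1 mul1r.
have [w wP] := choice Weuler.
apply: (@vspace_closed _ _ g w) => [|n]; last exact: (wP n).1.
apply: (@cvg_nm _ _ _ _ (fun n => c * harmonic n)) => [|n]; last exact: (wP n).2.
by rewrite -(mulr0 c); apply: cvgMr; apply: cvg_harmonic.
Qed.

Lemma bch_prod_mem (g : {vspace 'M[R]_N}) m : lie_subalgebra g ->
  exists rho C : R, [/\ 0 < rho, 0 <= C & forall d (U : 'I_m -> 'M[R]_N),
    d <= rho -> (forall j, U j \in g /\ nm (U j) <= d) -> 0 <= d ->
    exists Z, [/\ Z \in g, nm Z <= C * d & expm Z = \prod_(j < m) expm (U j)]].
Proof.
move=> glie; elim: m => [|m [rho [C [rho0 C0 IHm]]]].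
  exists 1, 0; split=> // d U _ _ _; exists 0; rewrite big_ord0 rpred0 nm0 mul0r.
  by rewrite expm0.
have e0 : 0 < expR 2 :> R := expR_gt0 _.
have C1 : 0 < C + 1 by rewrite ltr_wpDl.
exists (Num.min rho (bch_radius / (C + 1))), (4 * expR 2 * (C + 1)); split.
- by rewrite lt_min rho0 divr_gt0 ?bch_radius_gt0.
- by rewrite !mulr_ge0 ?expR_ge0 // ltW.
move=> d U; rewrite le_min => /andP[drho dC] Ud d0.
have [Z [Zg Zd ZE]] := IHm d (fun j => U (widen_ord (leqnSn m) j)) drho (fun j => Ud _) d0.
have [Umg Umd] := Ud ord_max.
have [|Z' [Z'g Z'd Z'E]] := bch_mem glie Zg Umg.
  by move: dC; rewrite ler_pdivlMr //; lra.
exists Z'; split=> //; last by rewrite big_ord_recr /= Z'E ZE.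
apply: le_trans Z'd _; rewrite -[leRHS]mulrA ler_wpM2l ?mulr_ge0 ?expR_ge0 //; lra.
Qed.

End GroupLikeProducts.

(** * Orders of magnitude with Lipschitz control *)
Section LipschitzOrder.
Context {R : realType} {N : nat}.
Variables (T : Type) (D : set T) (d : T -> T -> R).
Hypothesis d_ge0 : forall x y, 0 <= d x y.
Implicit Types (f g h : R -> T -> 'M[R]_N) (S Q : T -> 'M[R]_N).

(** Both the values of [f t] and its Lipschitz constant in [x] are [O(t ^ k)].
    Contraction estimates need the second bound, and products need the two
    together. *)
Definition lipO (k : nat) f := exists K tau : R, [/\ 0 <= K, 0 < tau &
  forall t x y, `|t| <= tau -> D x -> D y ->
    nm (f t x) <= K * `|t| ^+ k /\ nm (f t x - f t y) <= K * `|t| ^+ k * d x y].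

Lemma lipO_near k f g tau : 0 < tau ->
  (forall t x, `|t| <= tau -> D x -> f t x = g t x) -> lipO k f -> lipO k g.
Proof.
move=> tau0 fg [K [tau' [K0 tau'0 fK]]]; exists K, (Num.min tau tau'); split=> //.
  by rewrite lt_min tau0.
by move=> t x y; rewrite le_min => /andP[t1 t2] Dx Dy; rewrite -!fg //; apply: fK.
Qed.

Lemma lipO_ext k f g : (forall t x, f t x = g t x) -> lipO k f -> lipO k g.
Proof. by move=> fg; apply: (@lipO_near _ _ _ 1). Qed.

Lemma lipO_add k f g : lipO k f -> lipO k g -> lipO k (fun t x => f t x + g t x).
Proof.
move=> [K [tau [K0 tau0 fK]]] [L [tau' [L0 tau'0 gL]]].
exists (K + L), (Num.min tau tau'); split; rewrite ?addr_ge0 ?lt_min ?tau0 //.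
move=> t x y; rewrite le_min => /andP[t1 t2] Dx Dy.
have [f1 f2] := fK t x y t1 Dx Dy; have [g1 g2] := gL t x y t2 Dx Dy.
rewrite !mulrDl opprD addrACA; split.
  exact: le_trans (nmD _ _) (lerD f1 g1).
exact: le_trans (nmD _ _) (lerD f2 g2).
Qed.

Lemma lipO_lin (phi : {linear 'M[R]_N -> 'M[R]_N}) k f :
  lipO k f -> lipO k (fun t x => phi (f t x)).
Proof.
have [L L0 phiL] := mx_lin_bound phi.
move=> [K [tau [K0 tau0 fK]]]; exists (L * K), tau; split; rewrite ?mulr_ge0 //.
move=> t x y tt Dx Dy; have [f1 f2] := fK t x y tt Dx Dy.
rewrite -linearB -!mulrA; split.
  by apply: le_trans (phiL _) _; rewrite ler_wpM2l.
by apply: le_trans (phiL _) _; rewrite ler_wpM2l // mulrA.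
Qed.

Lemma lipO_opp k f : lipO k f -> lipO k (fun t x => - f t x).
Proof.
move=> [K [tau [K0 tau0 fK]]]; exists K, tau; split=> // t x y tt Dx Dy.
by rewrite nmN -opprD nmN; apply: fK.
Qed.

Lemma lipO_sub k f g : lipO k f -> lipO k g -> lipO k (fun t x => f t x - g t x).
Proof. by move=> fk /lipO_opp gk; apply: lipO_add. Qed.

Lemma lipO_mul j k f g : lipO j f -> lipO k g ->
  lipO (j + k) (fun t x => f t x * g t x).
Proof.
move=> [K [tau [K0 tau0 fK]]] [L [tau' [L0 tau'0 gL]]].
exists (2 * K * L), (Num.min tau tau'); split; rewrite ?mulr_ge0 ?lt_min ?tau0 //.
move=> t x y; rewrite le_min => /andP[t1 t2] Dx Dy.
have [f1 f2] := fK t x y t1 Dx Dy; have [g1 g2] := gL t x y t2 Dx Dy.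
have [f3 _] := fK t y x t1 Dy Dx.
have tj : 0 <= `|t| ^+ j by rewrite exprn_ge0.
have tk : 0 <= `|t| ^+ k by rewrite exprn_ge0.
rewrite exprD; set a := `|t| ^+ j in tj f1 f2 f3 *; set b := `|t| ^+ k in tk g1 g2 *.
have KaLb : 0 <= (K * a) * (L * b) by rewrite !mulr_ge0.
split.
  apply: le_trans (nmM _ _) _; apply: (@le_trans _ _ ((K * a) * (L * b))).
    by rewrite ler_pM ?nm_ge0.
  have -> : 2 * K * L * (a * b) = 2 * ((K * a) * (L * b)) by ring.
  lra.
have -> : f t x * g t x - f t y * g t y =
    (f t x - f t y) * g t x + f t y * (g t x - g t y).
  by rewrite mulrBl mulrBr addrA subrK.
apply: le_trans (nmD _ _) _; apply: le_trans (lerD (nmM _ _) (nmM _ _)) _.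
have -> : 2 * K * L * (a * b) * d x y = (K * a * d x y) * (L * b) + (K * a) * (L * b * d x y).
  by ring.
by apply: lerD; rewrite ler_pM ?nm_ge0.
Qed.

Lemma lipO_le j k f : (j <= k)%N -> lipO k f -> lipO j f.
Proof.
move=> jk [K [tau [K0 tau0 fK]]]; exists K, (Num.min 1 tau); split=> //.
  by rewrite lt_min ltr01.
move=> t x y; rewrite le_min => /andP[t1 t2] Dx Dy.
have [f1 f2] := fK t x y t2 Dx Dy.
have tjk : `|t| ^+ k <= `|t| ^+ j by rewrite ler_wiXn2l.
have Kt := ler_wpM2l K0 tjk.
split; first exact: le_trans f1 Kt.
by apply: le_trans f2 _; rewrite ler_wpM2r.
Qed.

Lemma lipO_scale (c : R) k f : lipO k f -> lipO k (fun t x => c *: f t x).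
Proof.
move=> [K [tau [K0 tau0 fK]]]; exists (`|c| * K), tau; split; rewrite ?mulr_ge0 //.
move=> t x y tt Dx Dy; have [f1 f2] := fK t x y tt Dx Dy.
rewrite -scalerBr !nmZ -!mulrA; split; rewrite ler_wpM2l //.
by rewrite mulrA.
Qed.

Lemma lipO_power j k f : lipO k f -> lipO (j + k) (fun t x => t ^+ j *: f t x).
Proof.
move=> [K [tau [K0 tau0 fK]]]; exists K, tau; split=> //.
move=> t x y tt Dx Dy; have [f1 f2] := fK t x y tt Dx Dy.
have -> : K * `|t| ^+ (j + k) = `|t| ^+ j * (K * `|t| ^+ k) by rewrite exprD; ring.
rewrite -scalerBr !nmZ normrX; split; rewrite -?mulrA ler_wpM2l ?exprn_ge0 //.
by rewrite mulrA.
Qed.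

Lemma lipO_exp_tail n f : lipO 1 f -> lipO n.+1 (fun t x => exp_tail n.+1 (f t x)).
Proof.
move=> [K [tau [K0 tau0 fK]]].
have K1 : 0 < K + 1 by rewrite ltr_wpDl.
exists (K ^+ n.+1 * expR 2), (Num.min tau (K + 1)^-1); split.
- by rewrite mulr_ge0 ?exprn_ge0 ?expR_ge0.
- by rewrite lt_min tau0 invr_gt0.
move=> t x y; rewrite le_min => /andP[t1 t2] Dx Dy.
have [f1 f2] := fK t x y t1 Dx Dy; have [f3 _] := fK t y x t1 Dy Dx.
rewrite expr1 in f1 f2 f3.
have r1 : K * `|t| <= 1.
  move: t2; rewrite -(ler_pM2l K1) divff ?gt_eqF // => t2; apply: le_trans t2.
  by rewrite ler_wpM2r // lerDl.
have r0 : 0 <= K * `|t| by rewrite mulr_ge0.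
have -> : K ^+ n.+1 * expR 2 * `|t| ^+ n.+1 = (K * `|t|) ^+ n * (K * `|t|) * expR 2.
  by rewrite -exprSr exprMn; ring.
split.
  apply: le_trans (nm_exp_tail _ f1 r1) _.
  by rewrite ler_wpM2r ?expR_ge0 // ler_wpM2l ?exprn_ge0.
apply: le_trans (exp_tail_lipschitz _ f1 f3 r1) _.
rewrite [leRHS]mulrAC ler_wpM2r ?expR_ge0 // -[leRHS]mulrA.
by rewrite ler_wpM2l ?exprn_ge0.
Qed.

(** The second part records that for small [t] the logarithm is the small one given
    by local inversion, on which the series of [exp] can be used. *)
Lemma lipO_log f : lipO 1 (fun t x => f t x - 1) ->
  lipO 1 (fun t x => logm (f t x)) /\
  exists2 tau, 0 < tau & forall t x, `|t| <= tau -> D x ->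
    [/\ expm (logm (f t x)) = f t x, principal_log_domain (f t x),
        is_principal_log (f t x) (logm (f t x)) &
        nm (logm (f t x)) <= log_radius / 4].
Proof.
move=> [K [tau [K0 tau0 fK]]]; have rr := @log_radius_le_half R.
have r0 := @log_radius_gt0 R; have K1 : 0 < K + 1 by rewrite ltr_wpDl.
pose tau' := Num.min tau (log_radius / 8 / (K + 1)).
have tau'0 : 0 < tau' by rewrite lt_min tau0 !divr_gt0.
have small t x : `|t| <= tau' -> D x ->
    nm (f t x - 1) <= K * `|t| /\ nm (f t x - 1) <= log_radius / 8.
  rewrite le_min => /andP[t1 t2] Dx; have [f1 _] := fK t x x t1 Dx Dx.
  rewrite expr1 in f1; split=> //; apply: le_trans f1 _.
  move: t2; rewrite ler_pdivlMr // => t2; apply: le_trans t2.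
  by rewrite mulrC ler_wpM2l // lerDl.
have logP t x : `|t| <= tau' -> D x -> exists X, [/\ expm X = f t x,
    nm X <= 2 * nm (f t x - 1), nm X <= log_radius / 4 & logm (f t x) = X].
  move=> tt Dx; have [s1 s2] := small t x tt Dx.
  have [|X XA XE] := @local_log_exists R N (f t x); first by lra.
  have X4 : nm X <= log_radius / 4 by lra.
  by exists X; split=> //; rewrite -XE logm_expm.
split; last first.
  exists tau' => // t x tt Dx; have [X [XE X2 X4 ->]] := logP t x tt Dx.
  have [s1 s2] := small t x tt Dx; split=> //.
    by apply: near1_principal_log_domain; lra.
  by rewrite -XE; apply: small_is_principal_log.
exists (2 * K), tau'; split; rewrite ?mulr_ge0 //.
move=> t x y tt Dx Dy; rewrite expr1.
have [X [XE X2 X4 ->]] := logP t x tt Dx; have [Y [YE Y2 Y4 ->]] := logP t y tt Dy.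
have [s1 s2] := small t x tt Dx; split; first by lra.
apply: le_trans (expm_bilipschitz _ _) _; [lra|lra|].
have [|_ f2] := fK t x y _ Dx Dy; first by move: tt; rewrite le_min => /andP[].
rewrite -!mulrA ler_wpM2l // XE YE mulrA -[t in `|t|]expr1.
by move: f2; rewrite expr1 opprD opprK addrACA addNr addr0.
Qed.

(** The Taylor polynomial of degree 2 of [exp (t S + t ^ 2 / 2 Q)]. *)
Definition exp_jet S Q (t : R) (x : T) : 'M[R]_N :=
  1 + t *: S x + (t ^+ 2 / 2) *: (S x * S x + Q x).

(** [f = exp (t S + t ^ 2 / 2 Q) + O(t ^ 3)], where writing the second order
    coefficient as [S ^ 2 + Q] makes [Q] the quantity that the logarithm reads
    off. *)
Definition has_exp_jet f S Q :=
  [/\ lipO 0 (fun _ => S), lipO 0 (fun _ => Q) &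
      lipO 3 (fun t x => f t x - exp_jet S Q t x)].

End LipschitzOrder.

(** * Second order jets of products of exponentials and of their logarithms *)
Section ExponentialJets.
Context {R : realType} {N : nat}.
Variables (T : Type) (D : set T) (d : T -> T -> R).
Hypothesis d_ge0 : forall x y, 0 <= d x y.
Implicit Types (f g h : R -> T -> 'M[R]_N) (S Q A P : T -> 'M[R]_N).
Local Notation lipO := (lipO D d).
Local Notation has_exp_jet := (has_exp_jet D d).

Lemma lipO_cst C : lipO 0 (fun _ _ => C : 'M[R]_N).
Proof.
exists (nm C), 1; split; rewrite ?nm_ge0 // => t x y _ _ _.
by rewrite subrr nm0 expr0 mulr1 mulr_ge0 ?nm_ge0.
Qed.

Lemma lipO_time S : lipO 0 (fun _ => S) -> lipO 1 (fun t x => t *: S x).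
Proof.
by move=> hS; apply: lipO_ext (lipO_power 1 hS) => t x; rewrite expr1.
Qed.

Lemma lipO_mul0 S A : lipO 0 (fun _ => S) -> lipO 0 (fun _ => A) ->
  lipO 0 (fun _ x => S x * A x).
Proof. exact: (@lipO_mul _ _ _ _ _ 0 0). Qed.

Lemma lipO_exp_jet S Q : lipO 0 (fun _ => S) -> lipO 0 (fun _ => Q) ->
  lipO 0 (exp_jet S Q) /\ lipO 1 (fun t x => exp_jet S Q t x - 1).
Proof.
move=> hS hQ.
have h1 : lipO 1 (fun t x => exp_jet S Q t x - 1).
  apply: (@lipO_ext _ _ _ _ _ _ (fun t x => t *: S x + t ^+ 2 *: (2^-1 *: (S x * S x + Q x)))).
    by move=> t x; rewrite /exp_jet scalerA; move: (_ *: _) (_ *: _) => a b; apply/matrixP => i j; rewrite !mxE; ring.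
  apply: lipO_add; first exact: lipO_time.
  apply: (@lipO_le _ _ _ _ _ d_ge0 1 2) => //; apply: (lipO_power 2); apply: lipO_scale.
  exact: (lipO_add (lipO_mul0 hS hS) hQ).
split=> //; apply: (@lipO_ext _ _ _ _ _ _ (fun t x => 1 + (exp_jet S Q t x - 1))).
  by move=> t x; rewrite addrC subrK.
by apply: lipO_add; [apply: lipO_cst|apply: (@lipO_le _ _ _ _ _ d_ge0 0 1)].
Qed.

Lemma has_exp_jet_order0 f S Q : has_exp_jet f S Q -> lipO 0 f.
Proof.
move=> [hS hQ hf]; have [h0 _] := lipO_exp_jet hS hQ.
apply: (@lipO_ext _ _ _ _ _ _ (fun t x => exp_jet S Q t x + (f t x - exp_jet S Q t x))).
  by move=> t x; rewrite addrC subrK.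
by apply: lipO_add => //; apply: (@lipO_le _ _ _ _ _ d_ge0 0 3).
Qed.

Lemma has_exp_jet_order1 f S Q : has_exp_jet f S Q -> lipO 1 (fun t x => f t x - 1).
Proof.
move=> [hS hQ hf]; have [_ h1] := lipO_exp_jet hS hQ.
apply: (@lipO_ext _ _ _ _ _ _ (fun t x => (exp_jet S Q t x - 1) + (f t x - exp_jet S Q t x))).
  by move=> t x; rewrite addrC addrA subrK.
by apply: lipO_add => //; apply: (@lipO_le _ _ _ _ _ d_ge0 1 3).
Qed.

Lemma has_exp_jet_expm A : lipO 0 (fun _ => A) ->
  has_exp_jet (fun t x => expm (t *: A x)) A (fun=> 0).
Proof.
move=> hA; split=> //; first exact: lipO_cst.
apply: lipO_ext (lipO_exp_tail 2 (lipO_time hA)) => t x.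
rewrite exp_tail3E /exp_jet addr0 -mscaleAl -mscaleAr !scalerA.
by rewrite [2^-1 * _]mulrC -expr2 addrAC subrr add0r.
Qed.

(** The Baker-Campbell-Hausdorff formula to second order:
    [S ^ 2 + 2 S A + A ^ 2 = (S + A) ^ 2 + [S, A]]. *)
Lemma has_exp_jet_mul f g S Q A P :
  has_exp_jet f S Q -> has_exp_jet g A P ->
  has_exp_jet (fun t x => f t x * g t x) (fun x => S x + A x)
    (fun x => Q x + P x + lie_bracket (S x) (A x)).
Proof.
move=> hf hg; have g0 := has_exp_jet_order0 hg.
have [hS hQ f3] := hf; have [hA hP g3] := hg.
have [J0 _] := lipO_exp_jet hS hQ.
have SA := lipO_mul0 hS hA; have AS := lipO_mul0 hA hS.
split; [exact: (lipO_add hS hA)|exact: (lipO_add (lipO_add hQ hP) (lipO_sub SA AS))|].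
pose a x := S x * S x + Q x; pose b x := A x * A x + P x.
have ha : lipO 0 (fun _ => a) := lipO_add (lipO_mul0 hS hS) hQ.
have hb : lipO 0 (fun _ => b) := lipO_add (lipO_mul0 hA hA) hP.
have jetM t x : exp_jet S Q t x * exp_jet A P t x -
    exp_jet (fun x => S x + A x) (fun x => Q x + P x + lie_bracket (S x) (A x)) t x =
    t ^+ 3 *: (2^-1 *: (S x * b x + a x * A x)) + t ^+ 4 *: (4^-1 *: (a x * b x)).
  rewrite /exp_jet -/(a x) -/(b x) /lie_bracket !mulmxE.
  have -> : (S x + A x) * (S x + A x) = (a x - Q x) + S x * A x + A x * S x + (b x - P x).
    by rewrite /a /b !addrK mulrDl !mulrDr !addrA.
  move: (a x) (b x) (S x) (A x) => a' b' S' A'.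
  rewrite !(mulrDl, mulrDr) !mul1r !mulr1 -!mscaleAl -!mscaleAr !scalerA.
  move: (S' * A') (A' * S') (S' * b') (a' * A') (a' * b') => s1 s2 s3 s4 s5.
  by apply/matrixP => i j; rewrite !mxE; field.
apply: (@lipO_ext _ _ _ _ _ _ (fun t x =>
    (f t x - exp_jet S Q t x) * g t x + exp_jet S Q t x * (g t x - exp_jet A P t x)
    + (t ^+ 3 *: (2^-1 *: (S x * b x + a x * A x)) + t ^+ 4 *: (4^-1 *: (a x * b x))))).
  move=> t x; rewrite -jetM mulrBl mulrBr.
  move: (f t x * g t x) (exp_jet S Q t x * g t x) (_ * _) (exp_jet _ _ _ _) => s1 s2 s3 s4.
  by apply/matrixP => i j; rewrite !mxE; ring.
apply: lipO_add; first apply: lipO_add.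
- exact: (lipO_mul f3 g0).
- exact: (lipO_mul J0 g3).
apply: lipO_add.
  apply: (lipO_power 3); apply: lipO_scale.
  exact: (lipO_add (lipO_mul0 hS hb) (lipO_mul0 ha hA)).
apply: (@lipO_le _ _ _ _ _ d_ge0 3 4) => //; apply: (lipO_power 4); apply: lipO_scale.
exact: (lipO_mul0 ha hb).
Qed.

Lemma has_exp_jet1 : has_exp_jet (fun _ _ => 1) (fun=> 0) (fun=> 0 : 'M[R]_N).
Proof.
split; [exact: lipO_cst|exact: lipO_cst|].
apply: (@lipO_ext _ _ _ _ _ _ (fun t x => t ^+ 3 *: 0)).
  by move=> t x; rewrite /exp_jet mul0r addr0 !scaler0 !addr0 subrr.
exact: (lipO_power 3 (lipO_cst 0)).
Qed.

Lemma has_exp_jet_prod m (A : 'I_m -> T -> 'M[R]_N) :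
  (forall j, lipO 0 (fun _ => A j)) ->
  has_exp_jet (fun t x => \prod_(j < m) expm (t *: A j x))
    (fun x => \sum_(j < m) A j x)
    (fun x => \sum_(i < m) \sum_(j < m | (i < j)%N) lie_bracket (A i x) (A j x)).
Proof.
elim: m A => [|m IHm] A hA.
  have := has_exp_jet1; congr has_exp_jet.
  - by apply/funext => t; apply/funext => x; rewrite big_ord0.
  - by apply/funext => x; rewrite big_ord0.
  - by apply/funext => x; rewrite big_ord0.
have := has_exp_jet_mul (IHm (fun j => A (widen_ord (leqnSn m) j)) (fun j => hA _))
  (has_exp_jet_expm (hA ord_max)).
congr has_exp_jet.
- by apply/funext => t; apply/funext => x; rewrite big_ord_recr.
- by apply/funext => x; rewrite big_ord_recr.
apply/funext => x; rewrite addr0 [RHS]big_ord_recr /= [X in _ = _ + X]big1 ?addr0; last first.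
  by move=> j; rewrite ltnNge -ltnS ltn_ord.
under [RHS]eq_bigr => i _.
  rewrite big_mkcond big_ord_recr -big_mkcond /= ltn_ord.
  over.
rewrite big_split /=; congr (_ + _).
rewrite /lie_bracket mulmx_suml mulmx_sumr -sumrB.
by apply: eq_bigr => i _.
Qed.

Lemma has_exp_jet_log f S Q : has_exp_jet f S Q ->
  lipO 3 (fun t x => logm (f t x) - (t *: S x + (t ^+ 2 / 2) *: Q x)).
Proof.
move=> hf; have [hS hQ f3] := hf.
have [Y1 [tau tau0 Ytau]] := lipO_log (has_exp_jet_order1 hf).
pose Y t x := logm (f t x).
have Y3 := lipO_exp_tail 2 Y1.
have SS := lipO_mul0 hS hS.
have tS := lipO_time hS.
have YY := lipO_mul Y1 Y1.
(* The logarithm solves [Y = f - 1 - Y ^ 2 / 2 + O(t ^ 3)].  Used with [Y = O(t)]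
   it gives [Y = t S + O(t ^ 2)], and used again the second order term. *)
have Yeq t x : `|t| <= tau -> D x -> (f t x - exp_jet S Q t x) - exp_tail 3 (Y t x)
    + (t ^+ 2 / 2) *: (S x * S x + Q x) - 2^-1 *: (Y t x * Y t x) = Y t x - t *: S x.
  move=> tt Dx; have [E _ _ _] := Ytau t x tt Dx; rewrite -/(Y t x) in E.
  rewrite -{1}E exp_tail3E /exp_jet; move: (Y t x * Y t x) (S x * S x + Q x) (exp_tail 3 _) => a b c.
  by apply/matrixP => i j; rewrite !mxE; ring.
have R2 : lipO 2 (fun t x => Y t x - t *: S x).
  apply: (lipO_near tau0 Yeq); apply: lipO_sub; last exact: (lipO_scale 2^-1 YY).
  apply: lipO_add; last first.
    apply: (@lipO_ext _ _ _ _ _ _ (fun t x => t ^+ 2 *: (2^-1 *: (S x * S x + Q x)))).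
      by move=> t x; rewrite scalerA.
    by apply: (lipO_power 2); apply: lipO_scale; exact: (lipO_add SS hQ).
  by apply: (@lipO_le _ _ _ _ _ d_ge0 2 3) => //; apply: lipO_sub.
have R3 : lipO 3 (fun t x => (Y t x - t *: S x) * Y t x + (t *: S x) * (Y t x - t *: S x)).
  by apply: lipO_add; [apply: (lipO_mul R2 Y1)|apply: (lipO_mul tS R2)].
apply: (lipO_near (f := fun t x => (f t x - exp_jet S Q t x) - exp_tail 3 (Y t x)
   - 2^-1 *: ((Y t x - t *: S x) * Y t x + (t *: S x) * (Y t x - t *: S x))) tau0); last first.
  by apply: lipO_sub; [apply: lipO_sub|apply: lipO_scale].
move=> t x tt Dx.
have -> : (Y t x - t *: S x) * Y t x + (t *: S x) * (Y t x - t *: S x) =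
    Y t x * Y t x - t ^+ 2 *: (S x * S x).
  by rewrite mulrBl mulrBr addrA subrK -!mscaleAl -!mscaleAr scalerA.
rewrite [in RHS]opprD [RHS]addrA -/(Y t x) -(Yeq t x tt Dx).
move: (Y t x * Y t x) (S x * S x) (exp_tail 3 _) (f t x - _) => a b c e.
by apply/matrixP => i j; rewrite !mxE; field.
Qed.

End ExponentialJets.

(** * Expansion of the logarithm of the splitting *)
Section ConjugatedProducts.
Context {R : realType} {N : nat}.
Implicit Types (A S X : 'M[R]_N).

Lemma conj_exprn S X k :
  (expm (- S) * X * expm S) ^+ k = expm (- S) * X ^+ k * expm S.
Proof.
elim: k => [|k IHk]; first by rewrite !expr0 mulr1 expmNK.
rewrite exprSr IHk [in RHS]exprSr; move: (expmKN S).
move: (expm (- S)) (expm S) (X ^+ k) => P' P Y PP'.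
by rewrite -!mulrA (mulrA P) PP' mul1r.
Qed.

Lemma conj_expm S X :
  expm (- S) * expm X * expm S = expm (expm (- S) * X * expm S).
Proof.
have maj := exp_term_majorized (lexx (nm X)).
rewrite [in LHS](expmE X) (msum_Lmul _ maj).
rewrite (@msum_Rmul _ _ _ (nm (expm (- S)) * N.+1%:R) (nm X)); last first.
  by move=> k; apply: le_trans (nmM _ _) _; rewrite -mulrA ler_wpM2l ?nm_ge0.
rewrite [RHS]expmE; congr msum; apply/funext => k.
by rewrite /exp_term conj_exprn -mscaleAr -mscaleAl.
Qed.

Lemma conj_prod_expm m S (A : 'I_m -> 'M[R]_N) :
  expm (- S) * (\prod_(j < m) expm (A j)) * expm S =
  \prod_(j < m) expm (expm (- S) * A j * expm S).
Proof.
elim: m A => [|m IHm] A; first by rewrite !big_ord0 mulr1 expmNK.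
rewrite !big_ord_recr /= -(conj_expm S (A ord_max)).
rewrite -(IHm (fun j => A (widen_ord (leqnSn m) j))); move: (expmKN S).
move: (expm (- S)) (expm S) (expm (A ord_max)) => P' P E PP'.
by rewrite -!mulrA (mulrA P) PP' mul1r.
Qed.

End ConjugatedProducts.

Section SplittingExpansion.
Context {R : realType} {N : nat}.
Local Notation M := 'M[R]_N.
Variables (m : nat) (bb : 'I_m -> {vspace M}).
Local Notation bsum := (\sum_(j < m) bb j)%VS.
Implicit Types (x y : M * M) (t : R).

Lemma sum_component v : v \in bsum -> \sum_(j < m) component bb j v = v.
Proof.
by move=> vb; rewrite /component; have := sumv_pi_sum (erefl bsum) vb.
Qed.

(** Two distances on pairs: the commutators of the components depend on the first
    entry alone, and their Lipschitz constant with respect to that entry alone is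
    needed in [iteration_estimate]. *)
Definition dist_pair x y : R := nm (x.1 - y.1) + nm (x.2 - y.2).
Definition dist_fst x y : R := nm (x.1 - y.1).

Lemma dist_pair_ge0 x y : 0 <= dist_pair x y.
Proof. by rewrite addr_ge0 ?nm_ge0. Qed.

Lemma dist_fst_ge0 x y : 0 <= dist_fst x y.
Proof. exact: nm_ge0. Qed.

Definition component_commutators v : M :=
  \sum_(i < m) \sum_(j < m | (i < j)%N) lie_bracket (component bb i v) (component bb j v).

Variables (D : set (M * M)) (B : R).
Hypothesis D_bsum : forall x, D x -> x.1 \in bsum.
Hypothesis D_bound : forall x, D x -> nm x.1 <= B /\ nm x.2 <= B.

Lemma lipO_bounded_linear (d : M * M -> M * M -> R) (p : M * M -> M)
    (phi : {linear M -> M}) : (forall x y, nm (p x - p y) <= d x y) ->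
  (forall x, D x -> nm (p x) <= B) -> lipO D d 0 (fun _ x => phi (p x)).
Proof.
move=> pd pB; apply: lipO_lin; exists (`|B| + 1), 1; split; rewrite ?addr_ge0 //.
move=> t x y _ Dx Dy; rewrite expr0 mulr1; split.
  by apply: le_trans (pB x Dx) _; rewrite ler_wpDr // ler_norm.
apply: le_trans (pd x y) _; rewrite ler_peMl ?lerDr //.
exact: le_trans (nm_ge0 _) (pd x y).
Qed.

Lemma component_linear j : exists phi : 'End(M), component bb j =1 phi.
Proof. by exists (sumv_pi bsum j). Qed.

Lemma lipO_component (d : M * M -> M * M -> R) j :
  (forall x y, dist_fst x y <= d x y) ->
  lipO D d 0 (fun _ x => component bb j x.1).
Proof.
move=> dd; have [phi phiE] := component_linear j.
apply: (@lipO_ext _ _ _ _ _ _ (fun _ x => phi x.1)) => [t x|]; first by rewrite phiE.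
apply: (@lipO_bounded_linear d fst phi) => // x Dx.
exact: (D_bound Dx).1.
Qed.

(** These commutators are the second order jet of [\prod_j exp (t b_j)]. *)
Lemma lipO_component_commutators (d : M * M -> M * M -> R) :
  (forall x y, dist_fst x y <= d x y) ->
  lipO D d 0 (fun _ x => component_commutators x.1).
Proof.
move=> dd; have d0 x y : 0 <= d x y := le_trans (dist_fst_ge0 x y) (dd x y).
by have [] := has_exp_jet_prod d0 (fun j => lipO_component j dd).
Qed.

Lemma splitting_jet : has_exp_jet D dist_pair (fun t x => splitting bb t x.1 x.2)
  (fun x => - x.2 + \sum_(j < m) component bb j x.1 + x.2)
  (fun x => 0 + component_commutators x.1
     + lie_bracket (- x.2) (\sum_(j < m) component bb j x.1) + 0
     + lie_bracket (- x.2 + \sum_(j < m) component bb j x.1) x.2).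
Proof.
have d0 := dist_pair_ge0.
have dd x y : dist_fst x y <= dist_pair x y by rewrite lerDl nm_ge0.
have hs : lipO D dist_pair 0 (fun _ x => x.2).
  apply: (@lipO_bounded_linear _ snd idfun) => [x y|x Dx]; last exact: (D_bound Dx).2.
  by rewrite lerDr nm_ge0.
have hNs : lipO D dist_pair 0 (fun _ x => - x.2) := lipO_opp hs.
have E : (fun t x => splitting bb t x.1 x.2) = (fun t x => expm (t *: - x.2) *
    (\prod_(j < m) expm (t *: component bb j x.1)) * expm (t *: x.2)).
  by apply/funext => t; apply/funext => x; rewrite /splitting scalerN scaleNr.
rewrite E; exact: (has_exp_jet_mul d0 (has_exp_jet_mul d0 (has_exp_jet_expm d0 hNs)
  (has_exp_jet_prod d0 (fun j => lipO_component j dd))) (has_exp_jet_expm d0 hs)).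
Qed.

(** In the jet the two conjugating factors cancel at first order, and at second
    order they contribute [[- s, b] + [b - s, s] = 2 [b, s]]. *)
Lemma log_splitting_expansion :
  lipO D dist_pair 3 (fun t x => logm (splitting bb t x.1 x.2)
    - (t *: x.1 + t ^+ 2 *: (2^-1 *: component_commutators x.1 + lie_bracket x.1 x.2))).
Proof.
have J := has_exp_jet_log dist_pair_ge0 splitting_jet.
refine (lipO_near ltr01 _ J) => t x _ Dx; rewrite sum_component; last exact: D_bsum.
congr (_ - _); rewrite addrAC addNr add0r; congr (_ + _).
rewrite add0r addr0 -scalerA; congr (_ *: _).
rewrite /lie_bracket mulmxDl mulmxDr !mulNmx !mulmxN.
move: (x.1 *m x.2) (x.2 *m x.1) (x.2 *m x.2) (component_commutators _) => p q s c.
by apply/matrixP => i j; rewrite !mxE; field.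
Qed.

Lemma splitting_sub1 : lipO D dist_pair 1 (fun t x => splitting bb t x.1 x.2 - 1).
Proof. by have := has_exp_jet_order1 dist_pair_ge0 splitting_jet. Qed.

End SplittingExpansion.

(** * Continuity of analytic maps *)
Section PowerSeriesContinuity.
Context {R : realType} {N : nat}.

Lemma geometric_half_le (q : R) n : 0 <= q -> q <= 2^-1 ->
  \sum_(k < n) q ^+ k.+1 <= 2 * q.
Proof.
move=> q0 q1; elim: n => [|n IHn]; first by rewrite big_ord0 mulr_ge0.
rewrite big_ord_recl expr1; under eq_bigr do rewrite lift0 exprS.
rewrite -mulr_sumr; have := ler_wpM2l q0 IHn; nra.
Qed.

(** The terms of the series at a fixed [h0 != 0] are bounded, so that at smaller
    [h] the series without its constant term is dominated by a geometric series of
    ratio [h / h0]. *)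
Lemma analytic_continuous_at (f : R -> 'M[R]_N) (D : set R) a : analytic_on D f -> D a ->
  forall e : R, 0 < e -> exists2 delta, 0 < delta &
    forall h, `|h| <= delta -> nm (f (a + h) - f a) <= e.
Proof.
move=> fD Da e e0; have [c [r [r0 fr]]] := fD a Da.
have c0 : f a = c 0%N.
  have := fr 0; rewrite normr0 addr0 => /(_ r0)/msumP <-.
  rewrite (@msum_fin _ _ 1) => [|[//|k] _]; last by rewrite exprS mul0r scale0r.
  by rewrite big_ord1 expr0 scale1r.
pose h0 := r / 2; have h00 : 0 < h0 by rewrite divr_gt0.
have h0r : `|h0| < r by rewrite gtr0_norm // /h0; lra.
have [B cB] : exists B, forall k, nm (h0 ^+ k *: c k) <= B.
  have /nm_cvg sl := fr h0 h0r.
  have [B0 [_ sB]] := cvg_seq_bounded (cvgP _ sl).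
  pose B := B0 + 1; have {sB}sB n : nm (series (fun k => h0 ^+ k *: c k) n - f (a + h0)) <= B.
    have := sB B; rewrite /B ltrDl ltr01 => /(_ isT n I) /=.
    by rewrite ger0_norm ?nm_ge0.
  exists (B + B) => k; set S := series _ in sB.
  have -> : h0 ^+ k *: c k = (S k.+1 - f (a + h0)) - (S k - f (a + h0)).
    rewrite opprB addrA subrK /S !seriesEnat /= big_nat_recr //=.
    by rewrite addrC addKr.
  exact: le_trans (nmB _ _) (lerD (sB _) (sB _)).
have B0 : 0 <= B := le_trans (nm_ge0 _) (cB 0%N).
have B1 : 0 < 2 * B + 1 by rewrite ltr_wpDl // mulr_ge0.
exists (Num.min (h0 / 2) (h0 * e / (2 * B + 1))).
  by rewrite lt_min !divr_gt0 // mulr_gt0.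
move=> h; rewrite le_min => /andP[h1 h2].
have hr : `|h| < r by move: h1; rewrite /h0; lra.
pose q := `|h| / h0; have q0 : 0 <= q by rewrite divr_ge0 // ltW.
have q1 : q <= 2^-1 by rewrite ler_pdivrMr // mulrC.
have := fr h hr; rewrite -cvg_shiftS => fh.
have fh' : (fun n => series (fun k => h ^+ k *: c k) n.+1 - c 0%N) @ \oo --> f (a + h) - f a.
  by rewrite c0; apply: (cvgB fh (cvg_cst (c 0%N))).
apply: (nm_cvg_le fh') => n; rewrite seriesEnat /= big_mkord big_ord_recl expr0 scale1r.
rewrite addrC addKr; apply: le_trans (nm_sum _ _ _) _.
apply: (@le_trans _ _ (\sum_(k < n) B * q ^+ k.+1)).
  apply: ler_sum => k _; rewrite lift0.
  have -> : h ^+ k.+1 *: c k.+1 = (h / h0) ^+ k.+1 *: (h0 ^+ k.+1 *: c k.+1).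
    by rewrite scalerA -exprMn divfK // gt_eqF.
  rewrite nmZ normrX normrM normfV (gtr0_norm h00) mulrC.
  by rewrite ler_wpM2r ?exprn_ge0.
rewrite -mulr_sumr; apply: le_trans (ler_wpM2l B0 (geometric_half_le n q0 q1)) _.
have : q * (2 * B + 1) <= e.
  by rewrite /q mulrAC ler_pdivrMr // [e * _]mulrC -ler_pdivlMr.
nra.
Qed.

End PowerSeriesContinuity.

(** * Error estimate for one step of the iteration *)
Section AdaptedProjections.
Context {R : realType} {N : nat}.
Local Notation M := 'M[R]_N.
Variables (b r s' : {vspace M}) (bs : M) (Pb Pr : 'End(M)).
Hypothesis Pb_proj : projection_along b r Pb.
Hypothesis Pr_proj : projection_along r b Pr.
Hypothesis Psi_iso : bijective (Psi bs Pr s' r).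

Lemma Pb_id v : v \in b -> Pb v = v.
Proof. by move=> vb; have := Pb_proj.2 v 0 vb (mem0v r); rewrite addr0. Qed.

Lemma Pr_b v : v \in b -> Pr v = 0.
Proof. by move=> vb; have := Pr_proj.2 0 v (mem0v r) vb; rewrite add0r. Qed.

Lemma Pb_in v : Pb v \in b.
Proof. exact: (subvP Pb_proj.1) _ (memv_img _ (memvf v)). Qed.

Lemma Psi_inv_in y : Psi_inv bs Pr s' r y \in s'.
Proof. exact: subvsP. Qed.

(** [Psi^-1 o Pi_r] is taken as an endomorphism of the space of all matrices: it is
    then bounded, wherever the logarithm to which it is applied lies. *)
Definition correction : 'End(M) :=
  (linfun (@vsval _ _ s') \o (Psi bs Pr s' r)^-1 \o linfun (@vsproj _ _ r) \o Pr)%VF.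

Lemma correctionE v : correction v = Psi_inv bs Pr s' r (Pr v).
Proof. by rewrite /correction !comp_lfunE !lfunE. Qed.

Lemma correction_b v : v \in b -> correction v = 0.
Proof. by move=> vb; rewrite /correction comp_lfunE Pr_b // linear0. Qed.

(** This cancellation is the reason for the choice of [Psi]: applied to the term
    [t [b_star, s]] of the logarithm divided by [t], the correction recovers the
    error in [s] exactly. *)
Lemma correction_bracket v : v \in s' -> correction (lie_bracket bs v) = v.
Proof.
move=> vs; rewrite correctionE /Psi_inv.
have -> : vsproj r (Pr (lie_bracket bs v)) = Psi bs Pr s' r (vsproj s' v).
  by rewrite /Psi !comp_lfunE !lfunE /= vsprojK.
rewrite lker0_lfunK ?vsprojK //; apply/lker0P; exact: bij_inj.
Qed.

End AdaptedProjections.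

Section Contraction.
Context {R : realType} {N : nat}.
Local Notation M := 'M[R]_N.
Variables (m : nat) (bb : 'I_m -> {vspace M}) (r s' : {vspace M}) (bs ss : M).
Variables (Pb Pr : 'End(M)).
Local Notation b := (\sum_(j < m) bb j)%VS.
Hypothesis Pb_proj : projection_along b r Pb.
Hypothesis Pr_proj : projection_along r b Pr.
Hypothesis Psi_iso : bijective (Psi bs Pr s' r).

(** The iteration stays in this bounded neighbourhood of its starting point, on
    which all constants are uniform. *)
Definition unit_domain : set (M * M) :=
  [set x | [/\ x.1 \in b, x.2 \in s', nm (x.1 - bs) <= 1 & nm (x.2 - ss) <= 1]].

Local Notation F t x := (log_splitting bb t x.1 x.2).
Local Notation corr := (correction r s' bs Pr).

Lemma unit_domain_b x : unit_domain x -> x.1 \in b.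
Proof. by case. Qed.

Lemma unit_domain_bound x : unit_domain x ->
  nm x.1 <= nm bs + nm ss + 1 /\ nm x.2 <= nm bs + nm ss + 1.
Proof.
case=> _ _ x1 x2; have b0 := nm_ge0 bs; have s0 := nm_ge0 ss.
have := nmD (x.1 - bs) bs; have := nmD (x.2 - ss) ss; rewrite !subrK.
by move=> ? ?; split; lra.
Qed.

(** The difference of two logarithms divided by [t] is
    [db + t (dC + dL) + O(t ^ 2)], where [dC] comes from the commutators of the
    components and [dL] from [[b, s]].  [Pb] fixes [db].  The correction kills
    [db] and multiplies the rest by [1 / t]; it recovers [ds] from the part
    [[b_star, ds]] of [dL], and [dC] and the other parts of [dL] are bounded by
    [db] and by [|b - b_star| ds]. *)
Lemma iteration_estimate : exists K tau : R, [/\ 0 <= K, 0 < tau &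
  forall t x y, `|t| <= tau -> t != 0 -> unit_domain x -> unit_domain y ->
    nm ((x.1 - y.1) - Pb (F t x - F t y)) <= K * `|t| * dist_pair x y /\
    nm ((x.2 - y.2) - t^-1 *: corr (F t x - F t y)) <=
      K * nm (x.1 - y.1) + K * nm (x.1 - bs) * nm (x.2 - y.2) + K * `|t| * dist_pair x y].
Proof.
have [K1 [tau1 [K10 tau10 E1]]] := log_splitting_expansion unit_domain_b unit_domain_bound.
have [K2 [tau2 [K20 tau20 E2]]] := lipO_component_commutators bb unit_domain_bound
  (fun x y => lexx (dist_fst x y)).
have [L1 L10 PbL] := mx_lin_bound Pb.
have [L2 L20 corrL] := mx_lin_bound corr.
have PbD X Y : Pb (X + Y) = Pb X + Pb Y by apply: linearD.
have corrD X Y : corr (X + Y) = corr X + corr Y by apply: linearD.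
have corrZ a X : corr (a *: X) = a *: corr X by apply: linearZ.
pose B := nm bs + nm ss + 1.
have B0 : 0 <= B by rewrite !addr_ge0 ?nm_ge0.
pose K := L1 * (K2 + 4 * B + K1) + L2 * (K2 + 4 * B + K1 + 2).
exists K, (Num.min 1 tau1).
have K0 : 0 <= K by rewrite /K; apply: addr_ge0; apply: mulr_ge0 => //; lra.
split=> //; first by rewrite lt_min ltr01.
move=> t x y; rewrite le_min => /andP[t1 tt] tn0 Dx Dy.
have [_ e1] := E1 t x y tt Dx Dy.
(* the family is constant in [t], and it is read at [t = 0] *)
have [|_ e2] := E2 0 x y _ Dx Dy; first by rewrite normr0 ltW.
rewrite expr0 mulr1 /dist_fst in e2.
move: e1; set rho := (X in nm X <= _) => e1.
pose db := x.1 - y.1; pose ds := x.2 - y.2; rewrite -/db -/ds.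
pose dC := 2^-1 *: (component_commutators bb x.1 - component_commutators bb y.1).
pose dL := lie_bracket x.1 x.2 - lie_bracket y.1 y.2.
have dF : F t x - F t y = db + t *: (dC + dL) + t^-1 *: rho.
  rewrite /log_splitting -scalerBr /rho /db /dC /dL.
  move: (logm _) (logm _) (lie_bracket _ _) (lie_bracket _ _) => X Y lx ly.
  move: (component_commutators _ _) (component_commutators _ _) => cx cy.
  by apply/matrixP => i j; rewrite !mxE; field.
have dbb : db \in b by rewrite rpredB ?unit_domain_b.
have dss : ds \in s' by case: Dx => _ xs _ _; case: Dy => _ ys _ _; rewrite rpredB.
have [xB1 xB2] := unit_domain_bound Dx; have [yB1 yB2] := unit_domain_bound Dy.
have a0 := nm_ge0 db; have c0 := nm_ge0 ds.
have dC_le : nm dC <= K2 * nm db.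
  rewrite /dC nmZ ger0_norm ?invr_ge0 //; have := nm_ge0 (component_commutators bb x.1 - component_commutators bb y.1).
  by move: e2; rewrite -/db; lra.
(* the part of [dL] that the correction inverts is separated from the small ones *)
have dLE : dL = lie_bracket bs ds + (lie_bracket (x.1 - bs) ds + lie_bracket db y.2).
  rewrite /dL /lie_bracket /db /ds !(mulmxBl, mulmxBr).
  move: (_ *m _) (_ *m _) (_ *m _) (_ *m _) (_ *m _) (_ *m _) (_ *m _) (_ *m _) => p1 p2 p3 p4 p5 p6 p7 p8.
  by apply/matrixP => i j; rewrite !mxE; ring.
have dE : dist_pair x y = nm db + nm ds by [].
clearbody db ds dC dL rho.
have brL (X Y : M) : nm (lie_bracket X Y) <= 2 * (nm X * nm Y).
  apply: le_trans (nmB _ _) _; apply: le_trans (lerD (nmM _ _) (nmM _ _)) _.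
  by rewrite (mulrC (nm Y)); lra.
have x1bs : nm (x.1 - bs) <= 1 by case: Dx.
have h1 := brL bs ds; have h2 := brL (x.1 - bs) ds; have h3 := brL db y.2.
set u := nm (x.1 - bs) in x1bs h2 *; have u0 : 0 <= u := nm_ge0 _.
have {}h3 : nm (lie_bracket db y.2) <= 2 * B * nm db.
  apply: le_trans h3 _; rewrite mulrA [leRHS]mulrAC ler_wpM2l ?mulr_ge0 //; lra.
have B1 : 1 <= B by rewrite /B; have := nm_ge0 bs; have := nm_ge0 ss; lra.
have dL_le : nm dL <= 4 * B * dist_pair x y.
  rewrite dLE; apply: le_trans (nmD _ _) _.
  have h23 := nmD (lie_bracket (x.1 - bs) ds) (lie_bracket db y.2).
  have bsB : nm bs * nm ds <= B * nm ds.
    by rewrite ler_wpM2r // /B; have := nm_ge0 ss; lra.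
  have uB : u * nm ds <= B * nm ds by rewrite ler_wpM2r //; lra.
  have Ba : 0 <= B * nm db by rewrite mulr_ge0.
  rewrite dE; lra.
clearbody B; clear E1 E2 xB1 xB2 yB1 yB2 e2.
have t0 : 0 < `|t| by rewrite normr_gt0.
have d0 := dist_pair_ge0 x y; set d := dist_pair x y in dE e1 dL_le d0 *.
have ad : nm db <= d by rewrite dE lerDl.
have rho1 : nm (t^-1 *: rho) <= K1 * `|t| * (`|t| * d).
  rewrite nmZ normfV ler_pdivrMl //; apply: le_trans e1 _.
  by rewrite le_eqVlt; apply/orP; left; apply/eqP; ring.
have rho2 : nm (t^-1 *: (t^-1 *: rho)) <= K1 * (`|t| * d).
  rewrite nmZ normfV ler_pdivrMl //; apply: le_trans rho1 _.
  by rewrite le_eqVlt; apply/orP; left; apply/eqP; ring.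
have td0 : 0 <= `|t| * d by rewrite mulr_ge0.
have K1td : K1 * `|t| * (`|t| * d) <= K1 * (`|t| * d).
  by rewrite ler_wpM2r // ler_piMr.
rewrite dF; split.
  have -> : db - Pb (db + t *: (dC + dL) + t^-1 *: rho) =
      - Pb (t *: (dC + dL) + t^-1 *: rho).
    by rewrite -addrA PbD (Pb_id Pb_proj dbb) opprD addrA subrr add0r.
  rewrite nmN; apply: le_trans (PbL _) _.
  have bnd : nm (t *: (dC + dL) + t^-1 *: rho) <= (K2 + 4 * B + K1) * (`|t| * d).
    apply: le_trans (nmD _ _) _; rewrite nmZ mulrDl; apply: lerD; last by lra.
    rewrite mulrCA ler_wpM2l //; apply: le_trans (nmD _ _) _.
    by have := ler_wpM2l K20 ad; lra.
  apply: le_trans (ler_wpM2l L10 bnd) _.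
  rewrite mulrA -[leRHS]mulrA ler_wpM2r // /K lerDl mulr_ge0 //; lra.
have -> : ds - t^-1 *: corr (db + t *: (dC + dL) + t^-1 *: rho) =
    - corr (dC + (lie_bracket (x.1 - bs) ds + lie_bracket db y.2) + t^-1 *: (t^-1 *: rho)).
  have cb : corr db = 0 := correction_b s' bs Pr_proj dbb.
  have cds : corr (lie_bracket bs ds) = ds by apply: correction_bracket.
  have [G GE] : exists G, G = lie_bracket (x.1 - bs) ds + lie_bracket db y.2.
    by eexists.
  have cdL : corr dL = ds + corr G by rewrite dLE -GE corrD cds.
  rewrite -GE !corrD !corrZ !corrD cb cdL add0r.
  move: (corr dC) (corr G) (corr rho) => z1 z2 z3.
  by apply/matrixP => i j; rewrite !mxE; field.
rewrite nmN; apply: le_trans (corrL _) _.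
have bnd : nm (dC + (lie_bracket (x.1 - bs) ds + lie_bracket db y.2) + t^-1 *: (t^-1 *: rho)) <=
    (K2 + 4 * B) * nm db + 2 * (u * nm ds) + K1 * (`|t| * d).
  apply: le_trans (nmD _ _) (lerD _ rho2); apply: le_trans (nmD _ _) _.
  have := nmD (lie_bracket (x.1 - bs) ds) (lie_bracket db y.2).
  have := mulr_ge0 B0 a0; lra.
apply: le_trans (ler_wpM2l L20 bnd) _.
have LK : L2 * (K2 + 4 * B + K1 + 2) <= K by rewrite /K lerDr mulr_ge0 //; lra.
have LE z : z <= K2 + 4 * B + K1 + 2 -> L2 * z <= K.
  by move=> zz; apply: le_trans (ler_wpM2l L20 zz) LK.
have -> : L2 * ((K2 + 4 * B) * nm db + 2 * (u * nm ds) + K1 * (`|t| * d)) =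
    (L2 * (K2 + 4 * B)) * nm db + (L2 * 2) * u * nm ds + (L2 * K1) * `|t| * d by ring.
clearbody K; apply: lerD; first apply: lerD.
- by apply: ler_wpM2r => //; apply: LE; lra.
- by do 2![apply: ler_wpM2r => //]; apply: LE; lra.
- by do 2![apply: ler_wpM2r => //]; apply: LE; lra.
Qed.

End Contraction.

(** * Membership of the logarithm in the Lie algebra *)
Section SplittingInLieAlgebra.
Context {R : realType} {N : nat}.
Local Notation M := 'M[R]_N.
Variables (m : nat) (bb : 'I_m -> {vspace M}) (s' : {vspace M}) (bs ss : M).
Local Notation b := (\sum_(j < m) bb j)%VS.

Lemma component_in j v : component bb j v \in bb j.
Proof. exact: memv_sum_pi. Qed.

Lemma component_bound : exists2 K : R, 0 <= K &
  forall j v, nm (component bb j v) <= K * nm v.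
Proof.
have H j : exists K : R, 0 <= K /\ forall v, nm (component bb j v) <= K * nm v.
  have [phi phiE] := component_linear bb j; have [K K0 phiK] := mx_lin_bound phi.
  by exists K; split=> // v; rewrite phiE; apply: phiK.
have [Kf KfP] := choice H; exists (\sum_j Kf j) => [|j v].
  by apply: sumr_ge0 => j _; have [] := KfP j.
apply: le_trans ((KfP j).2 v) _; rewrite ler_wpM2r ?nm_ge0 // (bigD1 j) //= lerDl.
by apply: sumr_ge0 => i _; have [] := KfP i.
Qed.

(** Conjugating each factor separately writes the splitting as a product of
    exponentials of [exp (- ad (t s)) (t b_j)], which are small elements of [g].  The
    logarithm of this product that lies in [g] is small, hence principal. *)
Lemma log_splitting_mem (g : {vspace M}) : lie_subalgebra g -> (b <= g)%VS ->
  exists2 tau : R, 0 < tau & forall t x, `|t| <= tau -> unit_domain bb s' bs ss x ->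
    {in g & s', forall X Y, lie_bracket X Y \in g} ->
    log_splitting bb t x.1 x.2 \in g.
Proof.
move=> glie bg; have [rho [C [rho0 C0 prodP]]] := bch_prod_mem m glie.
have [Kc Kc0 compK] := component_bound.
set B := nm bs + nm ss + 1; have B0 : 0 <= B by rewrite !addr_ge0 ?nm_ge0.
set E := N.+1%:R * expR B; have E0 : 0 <= E by rewrite mulr_ge0 ?expR_ge0.
pose G := E * (Kc * B) * E; have G0 : 0 <= G by rewrite !mulr_ge0.
have G1 : 0 < G + 1 by rewrite ltr_wpDl.
have C1 : 0 < C + 1 by rewrite ltr_wpDl.
have r0 := @log_radius_gt0 R.
exists (Num.min 1 (Num.min (rho / (G + 1)) (log_radius / 4 / ((C + 1) * (G + 1))))).
  by rewrite !lt_min ltr01 !divr_gt0 ?mulr_gt0.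
move=> t x; rewrite !le_min => /and3P[t1 trho tC] Dx gs.
have [xB sB] := unit_domain_bound Dx; rewrite -/B in xB sB.
have xs : x.2 \in s' by case: Dx.
have ts : nm (t *: x.2) <= B.
  by rewrite nmZ; apply: le_trans sB; rewrite ler_piMl ?nm_ge0.
have gts X : X \in g -> lie_bracket (t *: x.2) X \in g.
  move=> Xg; have -> : lie_bracket (t *: x.2) X = - lie_bracket X (t *: x.2).
    by rewrite /lie_bracket opprB.
  by rewrite linearZ /= -scalerN rpredZ // rpredN gs.
have [||| Z [Zg Zle ZE]] := prodP (G * `|t|)
  (fun j => expm (- (t *: x.2)) * (t *: component bb j x.1) * expm (t *: x.2)).
- move: trho; rewrite ler_pdivlMr // => h; apply: le_trans h.
  by rewrite mulrC ler_wpM2l // lerDl.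
- move=> j; split.
    apply: conj_stable => //; rewrite rpredZ //.
    by apply: subvP bg _ _; apply: subvP (sumv_sup j _ (subvv _)) _ (component_in j _).
  apply: le_trans (nmM _ _) _; apply: le_trans (ler_wpM2r (nm_ge0 _) (nmM _ _)) _.
  have -> : G * `|t| = E * (`|t| * (Kc * B)) * E by rewrite /G; ring.
  apply: ler_pM; rewrite ?mulr_ge0 ?nm_ge0 //; last exact: nm_expm.
  apply: ler_pM; rewrite ?nm_ge0 //; first by apply: nm_expm; rewrite nmN.
  rewrite nmZ ler_wpM2l //; apply: le_trans (compK _ _) _.
  by rewrite ler_wpM2l.
- by rewrite mulr_ge0.
have splitE : splitting bb t x.1 x.2 = expm Z.
  by rewrite ZE -conj_prod_expm /splitting scaleNr.
rewrite /log_splitting splitE logm_expm ?rpredZ //.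
apply: le_trans Zle _; move: tC; rewrite ler_pdivlMr ?mulr_gt0 // => h.
apply: le_trans h; have -> : C * (G * `|t|) = `|t| * (C * G) by ring.
by rewrite ler_wpM2l //; apply: ler_pM; rewrite ?lerDl.
Qed.

End SplittingInLieAlgebra.

(** * Convergence of the iteration *)
Section FinalBounds.
Context {R : realType} {N : nat}.
Local Notation M := 'M[R]_N.

Lemma nrm_le_nm (nrm : M -> R) : is_norm nrm ->
  exists2 C : R, 0 < C & forall A, nrm A <= C * nm A.
Proof.
case=> nrmD nrmZ nrm0.
have nrm00 : nrm 0 = 0 by rewrite -(scale0r (0 : M)) nrmZ normr0 mul0r.
have nrm_ge0 A : 0 <= nrm A.
  have := nrmD A (- A); rewrite subrr nrm00 -scaleN1r nrmZ normrN1 mul1r => h; lra.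
have nrm_sum (I : finType) (F : I -> M) : nrm (\sum_i F i) <= \sum_i nrm (F i).
  elim/big_ind2: _ => [|x a y c xa yc|//]; first by rewrite nrm00.
  exact: le_trans (nrmD _ _) (lerD xa yc).
exists (\sum_i \sum_j nrm (delta_mx i j) + 1).
  by rewrite ltr_wpDl // sumr_ge0 // => i _; rewrite sumr_ge0.
move=> A; rewrite mulrDl mul1r; apply: ler_wpDr; first exact: nm_ge0.
rewrite {1}(matrix_sum_delta A); apply: le_trans (nrm_sum _ _) _.
rewrite mulr_suml; apply: ler_sum => i _; apply: le_trans (nrm_sum _ _) _.
rewrite mulr_suml; apply: ler_sum => j _.
by rewrite nrmZ mulrC ler_wpM2l // coord_le_nm.
Qed.

(** [p] and [q] are the errors in [b] and in [s].  The only term without a small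
    factor is [K * p] in the bound of [q'], and the weight [4 * K + 1] of [p] makes
    it less than a quarter of the weighted error. *)
Lemma weighted_contraction (K tau u p q p' q' : R) :
  0 <= K -> 0 <= tau -> 0 <= p -> 0 <= q ->
  (4 * K + 2) * K * tau <= 8^-1 -> K * u <= 8^-1 ->
  p' <= K * tau * (p + q) -> q' <= K * p + K * u * q + K * tau * (p + q) ->
  (4 * K + 1) * p' + q' <= 2^-1 * ((4 * K + 1) * p + q).
Proof.
move=> K0 tau0 p0 q0 Ktau Ku p'le q'le.
have M0 : 0 <= 4 * K + 1 by lra.
have h1 := ler_wpM2l M0 p'le.
have h2 := ler_wpM2r q0 Ku.
have h3 := ler_wpM2r (addr_ge0 p0 q0) Ktau.
have h4 : 0 <= K * p by rewrite mulr_ge0.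
lra.
Qed.

Lemma contraction_constants (K : R) : 0 <= K -> exists eta tau : R,
  [/\ 0 < eta, 0 < tau, (4 * K + 3) * eta <= 8^-1, K * ((4 * K + 3) * eta) <= 8^-1 &
    forall t, t <= tau -> (4 * K + 2) * K * t <= 8^-1].
Proof.
move=> K0; pose c := (K + 1) * (4 * K + 3).
have c0 : 0 < c by rewrite mulr_gt0 //; lra.
have e0 : 0 < (8 * c)^-1 by rewrite invr_gt0 mulr_gt0.
have eE : (8 * c)^-1 * c = 8^-1 by rewrite invfM mulfVK // gt_eqF.
exists (8 * c)^-1, (8 * c)^-1; split=> //.
- by rewrite mulrC -eE ler_pM2l // /c ler_peMl //; lra.
- move: e0 eE; set w := (8 * c)^-1 => w0 <-.
  have -> : K * ((4 * K + 3) * w) = w * (K * (4 * K + 3)) by ring.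
  by rewrite ler_pM2l // /c ler_wpM2r //; lra.
move=> t tle; rewrite -eE [leRHS]mulrC.
have h : 0 <= (4 * K + 2) * K by rewrite mulr_ge0 //; lra.
apply: le_trans (ler_wpM2l h tle) _; rewrite ler_wpM2r ?(ltW e0) // /c; nra.
Qed.

End FinalBounds.

Section IteratesConverge.
Context {R : realType} {N : nat}.
Local Notation M := 'M[R]_N.
Variables (m : nat) (bb : 'I_m -> {vspace M}) (bsj : 'I_m -> M) (r s' : {vspace M}).
Variables (Pb Pr : 'End(M)).
Local Notation b := (\sum_(j < m) bb j)%VS.
Local Notation bs := (\sum_(j < m) bsj j).
Local Notation ss := (s_star bsj Pr s' r).
Local Notation D := (unit_domain bb s' bs ss).
Hypothesis Pb_proj : projection_along b r Pb.
Hypothesis Pr_proj : projection_along r b Pr.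
Hypothesis bs_in : bs \in b.
Variables (K eta t : R) (y : M * M).
Hypothesis K_ge0 : 0 <= K.
Hypothesis eta_ge0 : 0 <= eta.
Hypothesis eta_small : (4 * K + 3) * eta <= 8^-1.
Hypothesis K_eta_small : K * ((4 * K + 3) * eta) <= 8^-1.
Hypothesis t_small : (4 * K + 2) * K * `|t| <= 8^-1.
Hypothesis y_near : nm (y.1 - bs) <= eta /\ nm (y.2 - ss) <= eta.
Hypothesis y_fixed : log_splitting bb t y.1 y.2 = bs.
Hypothesis estimate : forall x, D x ->
  nm ((x.1 - y.1) - Pb (log_splitting bb t x.1 x.2 - log_splitting bb t y.1 y.2))
    <= K * `|t| * dist_pair x y /\
  nm ((x.2 - y.2) - t^-1 *: correction r s' bs Pr
      (log_splitting bb t x.1 x.2 - log_splitting bb t y.1 y.2)) <=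
    K * nm (x.1 - y.1) + K * nm (x.1 - bs) * nm (x.2 - y.2) + K * `|t| * dist_pair x y.

(** The weighted distance to the exact solution [y]. *)
Definition wdist (x : M * M) : R := (4 * K + 1) * nm (x.1 - y.1) + nm (x.2 - y.2).

Definition next (x : M * M) : M * M :=
  (x.1 + bs - Pb (log_splitting bb t x.1 x.2),
   x.2 - t^-1 *: Psi_inv bs Pr s' r (Pr (log_splitting bb t x.1 x.2))).

Lemma iteratesS k : iterates bb bsj r s' Pb Pr t k.+1 = next (iterates bb bsj r s' Pb Pr t k).
Proof. by rewrite /next /=; case: (iterates _ _ _ _ _ _ _ _). Qed.

Lemma wdist_components x : nm (x.1 - y.1) <= wdist x /\ nm (x.2 - y.2) <= wdist x.
Proof.
have p0 := nm_ge0 (x.1 - y.1); have q0 := nm_ge0 (x.2 - y.2).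
have Kp := mulr_ge0 K_ge0 p0; rewrite /wdist; split; lra.
Qed.

Lemma wdist_near_start x : wdist x <= (4 * K + 2) * eta ->
  nm (x.1 - bs) <= (4 * K + 3) * eta /\ nm (x.2 - ss) <= (4 * K + 3) * eta.
Proof.
have [h1 h2] := wdist_components x; have [y1 y2] := y_near.
have := nm_triangle y.1 x.1 bs; have := nm_triangle y.2 x.2 ss.
by move=> ? ? ?; split; lra.
Qed.

Lemma wdist_next x : D x -> wdist x <= (4 * K + 2) * eta ->
  wdist (next x) <= 2^-1 * wdist x.
Proof.
move=> Dx wx; have [e1 e2] := estimate Dx; have [xbs _] := wdist_near_start wx.
rewrite y_fixed /dist_pair in e1 e2.
have E1 : (next x).1 - y.1 = x.1 - y.1 - Pb (log_splitting bb t x.1 x.2 - bs).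
  have -> : Pb (log_splitting bb t x.1 x.2 - bs) = Pb (log_splitting bb t x.1 x.2) - bs.
    by rewrite linearB /= (Pb_id Pb_proj bs_in).
  by rewrite /next [(_, _).1]/= opprB [RHS]addrA (addrAC x.1 (- y.1)) [RHS]addrAC.
have E2 : (next x).2 - y.2 =
    x.2 - y.2 - t^-1 *: correction r s' bs Pr (log_splitting bb t x.1 x.2 - bs).
  have -> : correction r s' bs Pr (log_splitting bb t x.1 x.2 - bs) =
      Psi_inv bs Pr s' r (Pr (log_splitting bb t x.1 x.2)).
    by rewrite linearB /= (correction_b _ _ Pr_proj bs_in) subr0 correctionE.
  by rewrite /next addrAC.
rewrite -E1 in e1; rewrite -E2 in e2.
apply: weighted_contraction e1 e2; rewrite ?nm_ge0 //.
by apply: le_trans (ler_wpM2l K_ge0 xbs) K_eta_small.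
Qed.

(** The weighted error of the starting point is at most [(4 * K + 2) * eta].  It
    decreases, so that all the iterates remain in the region where one step halves
    it. *)
Lemma iterates_converge k :
  D (iterates bb bsj r s' Pb Pr t k) /\
  wdist (iterates bb bsj r s' Pb Pr t k) <= (4 * K + 2) * eta * 2 ^- k.
Proof.
have [y1 y2] := y_near.
elim: k => [|k [Dk wk]].
  split; first by split; rewrite /= ?subrr ?nm0 // rpredN rpredZ // Psi_inv_in.
  rewrite expr0 invr1 mulr1 /wdist /= (nm_distC bs) (nm_distC ss).
  have M0 : 0 <= 4 * K + 1 by rewrite addr_ge0 ?mulr_ge0.
  have -> : (4 * K + 2) * eta = (4 * K + 1) * eta + eta by ring.
  exact: lerD (ler_wpM2l M0 y1) y2.
set x := iterates _ _ _ _ _ _ _ k in Dk wk; rewrite iteratesS -/x.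
have c0 : 0 <= (4 * K + 2) * eta by rewrite mulr_ge0 // addr_ge0 ?mulr_ge0.
have le2 n : 2 ^- n <= 1 :> R by rewrite invf_le1 ?exprn_gt0 // exprn_ege1 // ler1n.
have wx : wdist x <= (4 * K + 2) * eta by apply: le_trans wk _; rewrite ler_piMr.
have wS : wdist (next x) <= (4 * K + 2) * eta * 2 ^- k.+1.
  apply: le_trans (wdist_next Dk wx) _.
  by rewrite exprS invfM mulrCA ler_wpM2l // invr_ge0.
split; last exact: wS.
have [|n1 n2] := @wdist_near_start (next x).
  by apply: le_trans wS _; rewrite ler_piMr.
have eta_le1 : (4 * K + 3) * eta <= 1.
  by apply: le_trans eta_small _; rewrite invf_le1 // ler1n.
have [xb xs _ _] := Dk; split.
- by rewrite rpredB ?rpredD // (Pb_in Pb_proj).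
- by rewrite rpredB ?rpredZ // Psi_inv_in.
- exact: le_trans n1 eta_le1.
- exact: le_trans n2 eta_le1.
Qed.

End IteratesConverge.

Theorem proposition2p4 (R : realType) (N : nat)
  (nrm : 'M[R]_N -> R) (nrm_norm : is_norm nrm)
  (* the subspaces b_1, ..., b_m, s of a real Lie algebra of matrices *)
  (L : {vspace 'M[R]_N}) (L_lie : lie_subalgebra L)
  (m : nat) (m_ge1 : (1 <= m)%N)
  (bb : 'I_m -> {vspace 'M[R]_N}) (s : {vspace 'M[R]_N})
  (bb_L : forall j, (bb j <= L)%VS) (s_L : (s <= L)%VS)
  (b : {vspace 'M[R]_N}) (b_def : b = (\sum_(j < m) bb j)%VS)
  (b_direct : directv (\sum_(j < m) bb j)%VS)
  (* b_star and the Lie algebra g *)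
  (bsj : 'I_m -> 'M[R]_N) (bsj_in : forall j, bsj j \in bb j)
  (bs : 'M[R]_N) (bs_def : bs = \sum_(j < m) bsj j)
  (g : {vspace 'M[R]_N}) (g_def : g = (b + ad bs @: s)%VS)
  (g_lie : lie_subalgebra g)
  (* r, s', the projections, Psi *)
  (r : {vspace 'M[R]_N}) (r_compl : (b + r)%VS = g) (r_direct : directv (b + r))
  (s' : {vspace 'M[R]_N}) (s'_s : (s' <= s)%VS)
  (Pb Pr : 'End('M[R]_N))
  (Pb_proj : projection_along b r Pb) (Pr_proj : projection_along r b Pr)
  (Psi_iso : bijective (Psi bs Pr s' r))
  (* t0 and the analytic exact splitting *)
  (t0 : R) (t0_gt0 : 0 < t0) (bt st : R -> 'M[R]_N)
  (bt_in : forall t, `|t| < t0 -> bt t \in b)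
  (st_in : forall t, `|t| < t0 -> st t \in s')
  (bt_analytic : analytic_on `]- t0, t0[ bt)
  (st_analytic : analytic_on `]- t0, t0[ st)
  (bt0 : bt 0 = bs) (st0 : st 0 = s_star bsj Pr s' r)
  (exact_splitting : forall t, `|t| < t0 ->
     expm (t *: bs) = splitting bb t (bt t) (st t)) :
  let bk t k := (iterates bb bsj r s' Pb Pr t k).1 in
  let sk t k := (iterates bb bsj r s' Pb Pr t k).2 in
  exists t1 : R, [/\ 0 < t1, t1 < t0,
    (* the sequence is well defined in b * s' *)
    forall t, `|t| < t1 -> t != 0 -> forall k,
      [/\ bk t k \in b, sk t k \in s',
          principal_log_domain (splitting bb t (bk t k) (sk t k)),
          is_principal_log (splitting bb t (bk t k) (sk t k))
                           (logm (splitting bb t (bk t k) (sk t k))) &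
          {in g & s', forall x y, lie_bracket x y \in g} ->
            log_splitting bb t (bk t k) (sk t k) \in g] &
    exists C : R, 0 < C /\
      forall t, `|t| < t1 -> t != 0 -> forall k,
        nrm (bk t k - bt t) + nrm (sk t k - st t) <= C * 2 ^- k].
Proof.
move=> bk sk; subst b bs.
have bs_in : \sum_(j < m) bsj j \in (\sum_(j < m) bb j)%VS.
  by apply: memv_sumr => j _; apply: bsj_in.
have bg : (\sum_(j < m) bb j <= g)%VS by rewrite g_def addvSl.
have [K [tau1 [K0 tau10 est]]] :=
  iteration_estimate (s_star bsj Pr s' r) Pb_proj Pr_proj Psi_iso.
have [_ [tau2 tau20 logP]] := lipO_log (splitting_sub1 bb
  (@unit_domain_bound _ _ m bb s' (\sum_(j < m) bsj j) (s_star bsj Pr s' r))).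
have [tau3 tau30 memP] :=
  log_splitting_mem s' (\sum_(j < m) bsj j) (s_star bsj Pr s' r) g_lie bg.
have bs1 : 0 < nm (\sum_(j < m) bsj j) + 1 by rewrite ltr_wpDl // nm_ge0.
pose tau4 := log_radius / 4 / (nm (\sum_(j < m) bsj j) + 1).
have tau40 : 0 < tau4 by rewrite !divr_gt0 // log_radius_gt0.
have [eta [tau5 [eta0 tau50 etaS etaK tau5K]]] := contraction_constants K0.
have D0 : `]- t0, t0[%classic 0 by rewrite /= in_itv /= oppr_lt0 t0_gt0.
have [d1 d10 btc] := analytic_continuous_at bt_analytic D0 eta0.
have [d2 d20 stc] := analytic_continuous_at st_analytic D0 eta0.
pose t1 := Num.min (t0 / 2) (Num.min tau1 (Num.min tau2 (Num.min tau3
  (Num.min tau4 (Num.min tau5 (Num.min d1 d2)))))).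
have t10 : 0 < t1.
  by rewrite !lt_min tau10 tau20 tau30 tau40 tau50 d10 d20 divr_gt0.
have t1t0 : t1 < t0.
  by rewrite gt_min ltr_pdivrMr // ltr_pMr // ltr1n.
have main t : `|t| < t1 -> t != 0 -> forall k,
    unit_domain bb s' (\sum_(j < m) bsj j) (s_star bsj Pr s' r)
      (iterates bb bsj r s' Pb Pr t k) /\
    wdist K (bt t, st t) (iterates bb bsj r s' Pb Pr t k)
      <= (4 * K + 2) * eta * 2 ^- k.
  move=> tt tn0; have tlt0 := lt_trans tt t1t0; move: tt.
  rewrite !lt_min => /and4P[_ /ltW tt1 _ /and5P[_ /ltW tt4 /ltW tt5 /ltW tt6 /ltW tt7]].
  have near : nm (bt t - \sum_(j < m) bsj j) <= eta /\
      nm (st t - s_star bsj Pr s' r) <= eta.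
    by have := btc t tt6; have := stc t tt7; rewrite !add0r bt0 st0.
  have eta1 : eta <= 1.
    have h : 1 <= 4 * K + 3 by rewrite ler_wpDl ?mulr_ge0 // ler1n.
    apply: le_trans (_ : (4 * K + 3) * eta <= _); first by rewrite ler_peMl ?(ltW eta0).
    by apply: le_trans etaS _; rewrite invf_le1 // ler1n.
  have Dy : unit_domain bb s' (\sum_(j < m) bsj j) (s_star bsj Pr s' r) (bt t, st t).
    by split; rewrite /= ?bt_in ?st_in ?(le_trans near.1) ?(le_trans near.2).
  have yF : log_splitting bb t (bt t, st t).1 (bt t, st t).2 = \sum_(j < m) bsj j.
    rewrite /log_splitting -exact_splitting // logm_expm.
      by rewrite scalerA mulVf // scale1r.
    rewrite nmZ; move: tt4; rewrite /tau4 ler_pdivlMr // => h.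
    by apply: le_trans h; rewrite ler_wpM2l // lerDl.
  move=> k; have H := iterates_converge (y := (bt t, st t)) Pb_proj Pr_proj bs_in K0 (ltW eta0) etaS etaK
    (tau5K _ tt5) near yF (fun x Dx => est t x _ tt1 tn0 Dx Dy).
  exact: H.
exists t1; split=> // [t tt tn0 k|].
  have [Dk _] := main t tt tn0 k.
  move: tt; rewrite !lt_min => /and4P[_ _ /ltW tt2 /andP[/ltW tt3 _]].
  have [_ dom plog _] := logP t _ tt2 Dk.
  by have [kb ks _ _] := Dk; split=> //; exact: memP.
have [Cn Cn0 nrmC] := nrm_le_nm nrm_norm.
exists (Cn * (2 * ((4 * K + 2) * eta))); split.
  by rewrite !mulr_gt0 //; lra.
move=> t tt tn0 k; have [_ wk] := main t tt tn0 k.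
have [w1 w2] := wdist_components (bt t, st t) K0 (iterates bb bsj r s' Pb Pr t k).
apply: le_trans (lerD (nrmC _) (nrmC _)) _; rewrite -mulrDr -!mulrA ler_pM2l //.
apply: le_trans (lerD w1 w2) _; rewrite mulrA; move: wk; lra.
Qed.
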